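(* SMC (finding a feasible matching with the minimum number of blocking pairs, or reporting that no feasible matching exists) can be solved in time $O\big(|I|^{(\Delta_{\mathcal M}-1)|\mathcal W^\star|+(\Delta_{\mathcal W}-1)|\mathcal M^\star|+1}\big)$, where $|I|$ is the size of the instance $I$.
   Context: An instance of Stable Marriage with Covering Constraints (SMC) consists of a finite set $\mathcal M$ of men, a finite set $\mathcal W$ of women, for each person $x$ a preference list $L(x)$ strictly ordering a subset of the opposite sex (the persons acceptable to $x$), and subsets $\mathcal W^\star\subseteq\mathcal W$, $\mathcal M^\star\subseteq\mathcal M$ of distinguished persons. A matching is a set of disjoint man–woman pairs $\{m,w\}$ with $m$ and $w$ in each other's lists; $M(x)$ denotes the partner of $x$. A pair $\{m,w\}$ of mutually acceptable persons is blocking for $M$ if $m$ is unmatched or prefers $w$ to $M(m)$, and $w$ is unmatched or prefers $m$ to $M(w)$. A matching is feasible if it matches every person in $\mathcal W^\star\cup\mathcal M^\star$. $\Delta_{\mathcal M}$ and $\Delta_{\mathcal W}$ denote the maximum length of the preference list of a man and of a woman, respectively. *)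

(* Defs.v *)
From mathcomp Require Import all_boot all_order.

Set Implicit Arguments.
Unset Strict Implicit.
Unset Printing Implicit Defensive.

(* Acceptability need not be mutual: [mlist m] may contain a woman whose own
   list omits [m].  Most preferred persons come first. *)
Record smc := SMC {
  nmen : nat;
  nwomen : nat;
  mlist : 'I_nmen -> seq 'I_nwomen;
  wlist : 'I_nwomen -> seq 'I_nmen;
  mstar : {set 'I_nmen};
  wstar : {set 'I_nwomen};
  mlist_uniq : forall m, uniq (mlist m);
  wlist_uniq : forall w, uniq (wlist w)
}.

Definition edge (I : smc) : Type := ('I_(nmen I) * 'I_(nwomen I))%type.

Definition acceptable (I : smc) (m : 'I_(nmen I)) (w : 'I_(nwomen I)) : bool :=
  (w \in mlist m) && (m \in wlist w).

Definition is_matching (I : smc) (M : {set edge I}) : Prop :=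
  (forall m w, (m, w) \in M -> acceptable m w) /\
  (forall e f : edge I, e \in M -> f \in M -> e != f ->
     e.1 != f.1 /\ e.2 != f.2).

Definition mpartner (I : smc) (M : {set edge I}) (m : 'I_(nmen I)) :
  option 'I_(nwomen I) := [pick w | (m, w) \in M].

Definition wpartner (I : smc) (M : {set edge I}) (w : 'I_(nwomen I)) :
  option 'I_(nmen I) := [pick m | (m, w) \in M].

Definition mprefers (I : smc) (m : 'I_(nmen I)) (w w' : 'I_(nwomen I)) : bool :=
  index w (mlist m) < index w' (mlist m).

Definition wprefers (I : smc) (w : 'I_(nwomen I)) (m m' : 'I_(nmen I)) : bool :=
  index m (wlist w) < index m' (wlist w).

Definition blocking (I : smc) (M : {set edge I})
    (m : 'I_(nmen I)) (w : 'I_(nwomen I)) : bool :=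
  [&& acceptable m w,
      if mpartner M m is Some w' then mprefers m w w' else true &
      if wpartner M w is Some m' then wprefers w m m' else true].

Definition blocking_pairs (I : smc) (M : {set edge I}) : {set edge I} :=
  [set e : edge I | blocking M e.1 e.2].

Definition feasible (I : smc) (M : {set edge I}) : Prop :=
  [/\ is_matching M,
      forall m, m \in mstar I -> mpartner M m != None &
      forall w, w \in wstar I -> wpartner M w != None].

Definition optimal (I : smc) (M : {set edge I}) : Prop :=
  feasible M /\
  forall M' : {set edge I}, feasible M' ->
    #|blocking_pairs M| <= #|blocking_pairs M'|.

Definition smc_answer (I : smc) (r : option {set edge I}) : Prop :=
  if r is Some M then optimal M else forall M : {set edge I}, ~ feasible M.

Definition DeltaM (I : smc) : nat := \max_(m < nmen I) size (mlist m).
Definition DeltaW (I : smc) : nat := \max_(w < nwomen I) size (wlist w).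

(* Random access machine with structured control flow.  Registers and memory
   cells are addressed by natural numbers; a program only mentions finitely
   many registers, and memory is accessed indirectly through registers. *)
Inductive expr :=
| Const of nat
| Reg of nat
| Add of nat & nat
| Sub of nat & nat    (* truncated at 0 *)
| Read of nat.

Inductive test := Lt of nat & nat | Eq of nat & nat.

Inductive cmd :=
| Skip
| Assign of nat & expr
| Write of nat & nat    (* [Write a v]: cell addressed by register a := register v *)
| Seq of cmd & cmd
| If of test & cmd & cmd
| While of test & cmd.

Record state := State { reg : nat -> nat; mem : nat -> nat }.

Definition upd (f : nat -> nat) (x v : nat) : nat -> nat :=
  fun y => if y == x then v else f y.

Definition eval (e : expr) (s : state) : nat :=
  match e with
  | Const n => n
  | Reg x => reg s x
  | Add x y => reg s x + reg s y
  | Sub x y => reg s x - reg s y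
  | Read x => mem s (reg s x)
  end.

Definition holds (b : test) (s : state) : bool :=
  match b with
  | Lt x y => reg s x < reg s y
  | Eq x y => reg s x == reg s y
  end.

(* [exec B p s s' t]: with words restricted to values below [B], program [p]
   started in [s] halts in [s'] after [t] unit-cost steps.  A computation that
   would put a value >= B in a register is stuck, hence never counts as
   halting. *)
Inductive exec (B : nat) : cmd -> state -> state -> nat -> Prop :=
| ExecSkip s : exec B Skip s s 1
| ExecAssign x e s :
    eval e s < B ->
    exec B (Assign x e) s (State (upd (reg s) x (eval e s)) (mem s)) 1
| ExecWrite a v s :
    exec B (Write a v) s (State (reg s) (upd (mem s) (reg s a) (reg s v))) 1
| ExecSeq p q s1 s2 s3 t u :
    exec B p s1 s2 t -> exec B q s2 s3 u -> exec B (Seq p q) s1 s3 (t + u)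
| ExecIfTrue b p q s s' t :
    holds b s -> exec B p s s' t -> exec B (If b p q) s s' t.+1
| ExecIfFalse b p q s s' t :
    ~~ holds b s -> exec B q s s' t -> exec B (If b p q) s s' t.+1
| ExecWhileTrue b p s1 s2 s3 t u :
    holds b s1 -> exec B p s1 s2 t -> exec B (While b p) s2 s3 u ->
    exec B (While b p) s1 s3 (t + u).+1
| ExecWhileFalse b p s :
    ~~ holds b s -> exec B (While b p) s s 1.

Definition init_state (input : seq nat) : state :=
  State (fun=> 0) (nth 0 input).

Definition outputs (s : state) (output : seq nat) : Prop :=
  forall i, i < size output -> mem s i = nth 0 output i.

(* The problem of finding, for each instance [x], some [y] with [sol x y] can
   be solved in time O(T x): a single program does so, with one constant [c]
   for all instances, on words of k * log2 n bits for input length [n]. *)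
Definition solvable_in_time (X : Type) (Y : X -> Type)
    (inp : X -> seq nat) (out : forall x, Y x -> seq nat)
    (sol : forall x, Y x -> Prop) (T : X -> nat) : Prop :=
  exists (p : cmd) (c k : nat), forall x : X,
  exists (s : state) (t : nat) (y : Y x),
    [/\ exec (size (inp x) ^ k) p (init_state (inp x)) s t,
        t <= c * T x,
        sol x y &
        outputs s (out x y)].

(* Each person is written as: a flag telling whether he or she is
   distinguished, the length of the list, and the list itself. *)
Definition encode_person (n : nat) (star : bool) (l : seq 'I_n) : seq nat :=
  [:: nat_of_bool star, size l & [seq val i | i <- l]].

Definition encode_smc (I : smc) : seq nat :=
  [:: nmen I, nwomen I &
      flatten [seq encode_person (m \in mstar I) (mlist m) | m <- enum 'I_(nmen I)]
   ++ flatten [seq encode_person (w \in wstar I) (wlist w) | w <- enum 'I_(nwomen I)]].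

(* "No feasible matching" is the word 0; a matching is the word 1 followed by,
   for each man, 0 if he is unmatched and w + 1 if his partner is w. *)
Definition encode_answer (I : smc) (r : option {set edge I}) : seq nat :=
  if r is Some M then
    1 :: [seq (if mpartner M m is Some w then (val w).+1 else 0)
         | m <- enum 'I_(nmen I)]
  else [:: 0].

Definition isize (I : smc) : nat := size (encode_smc I).

(* Main.v *)
Require Import Defs.
From mathcomp Require Import all_boot all_order.
From mathcomp Require Import zify.

(* Delete a set [D] of edges and take a stable matching of what remains: in the
   full instance it is blocked by edges of [D] only. Conversely a feasible matching
   is stable once its blocking pairs are deleted, and by the rural hospitals
   theorem all stable matchings of the remaining instance cover the same persons.
   Hence the optimum is the least size of a [D] whose deletion makes
   Gale-Shapley return a feasible matching. If a feasible matching [F] exists, such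
   a [D] is obtained by deleting, for each distinguished person, the other edges
   at the partner in [F]; this bounds its size by the exponent of the theorem. So it
   suffices to run Gale-Shapley, in linear time, on all codes of edge sets of that
   size. *)

Set Implicit Arguments.
Unset Strict Implicit.
Unset Printing Implicit Defensive.

(** * Stable matchings after deletion of edges *)

Section Stability.
Variable I : smc.
Implicit Types (D M F : {set edge I}) (m : 'I_(nmen I)) (w : 'I_(nwomen I)).

(** Deletion never renumbers the lists: stability without [D] is expressed by the preferences of the
    full instance, since deletions preserve the relative order of the remaining entries. Three
    obstacles shape the implementation. A code ranges up to a power of the input length whose
    exponent varies with the instance, so it does not fit in a word; it is stored as an array of
    digits in base [isize I] and incremented with carry. The [+ 1] in the exponent pays for one
    attempt, so resetting, deleting, proposing, checking and incrementing must all be linear; in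
    particular a woman must compare two men in constant time, which requires a table of ranks. The
    table may have more than linearly many entries, but only the listed pairs are written and the
    other cells keep their initial 0. Finally, the machine has a single memory and no
    multiplication, so the algorithm is verified in a language with named arrays and then compiled.
    The least [D] need not be searched for separately: since small sets have small codes, the first
    successful code already gives an optimum. *)

Definition stable_up_to D M :=
  [/\ is_matching M, [disjoint M & D] & blocking_pairs M \subset D].

Lemma mpartnerP M m w : is_matching M ->
  reflect (mpartner M m = Some w) ((m, w) \in M).
Proof.
move=> [_ dM]; rewrite /mpartner; case: pickP => [w' mw'|none].
  apply: (iffP idP) => [mw|[<-] //].
  case: (eqVneq w' w) => [-> //|ne].
  have ne2 : (m, w') != (m, w) by apply: contra ne => /eqP[->].
  by have [] := dM _ _ mw' mw ne2; rewrite eqxx.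
by apply: (iffP idP) => //; rewrite none.
Qed.

Lemma wpartnerP M m w : is_matching M ->
  reflect (wpartner M w = Some m) ((m, w) \in M).
Proof.
move=> [_ dM]; rewrite /wpartner; case: pickP => [m' mw'|none].
  apply: (iffP idP) => [mw|[<-] //].
  case: (eqVneq m' m) => [-> //|ne].
  have ne2 : (m', w) != (m, w) by apply: contra ne => /eqP[->].
  by have [] := dM _ _ mw' mw ne2; rewrite eqxx.
by apply: (iffP idP) => //; rewrite none.
Qed.

Lemma matching_fst M m w w' : is_matching M ->
  (m, w) \in M -> (m, w') \in M -> w = w'.
Proof. by move=> h /(mpartnerP _ _ h) e /(mpartnerP _ _ h); rewrite e => -[]. Qed.

Lemma matching_snd M m m' w : is_matching M ->
  (m, w) \in M -> (m', w) \in M -> m = m'.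
Proof. by move=> h /(wpartnerP _ _ h) e /(wpartnerP _ _ h); rewrite e => -[]. Qed.

Lemma blocking_notin M m w : is_matching M -> (m, w) \in M -> ~~ blocking M m w.
Proof.
move=> h mw; rewrite /blocking (elimT (mpartnerP _ _ h) mw) /mprefers ltnn.
by rewrite andbF.
Qed.

Lemma stable_up_to_blocking_pairs M :
  is_matching M -> stable_up_to (blocking_pairs M) M.
Proof.
move=> h; split=> //; rewrite disjoint_subset; apply/subsetP => -[m w] mw.
by rewrite !inE /=; apply: blocking_notin.
Qed.

Lemma index_neq (T : eqType) (s : seq T) x y :
  x \in s -> x != y -> index x s != index y s.
Proof.
move=> xs; apply: contra => /eqP e; have ys : y \in s by rewrite -index_mem -e index_mem.
by rewrite -(nth_index x xs) -[X in _ == X](nth_index x ys) e.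
Qed.

(* Improving edges of [M1] for men and of [M2] for women are equinumerous:
   stability of each matching maps one set of edges into the other. *)
Lemma stable_up_to_covers D M1 M2 :
  stable_up_to D M1 -> stable_up_to D M2 ->
  (forall m w, (m, w) \in M1 -> mpartner M2 m != None) /\
  (forall m w, (m, w) \in M2 -> wpartner M1 w != None).
Proof.
move=> [h1 d1 b1] [h2 d2 b2].
have nd1 e : e \in M1 -> ~~ blocking M2 e.1 e.2.
  move=> eM; apply: contraTN (eM) => be; rewrite (disjointFl d1) //.
  by apply: (subsetP b2); rewrite inE.
have nd2 e : e \in M2 -> ~~ blocking M1 e.1 e.2.
  move=> eM; apply: contraTN (eM) => be; rewrite (disjointFl d2) //.
  by apply: (subsetP b1); rewrite inE.
(* [P] collects the edges of [M1] whose man is better off than in [M2], and [Q] those of [M2] whose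
   woman is better off than in [M1]; being unmatched counts as worst. *)
pose P := [set e in M1 | if mpartner M2 e.1 is Some w' then mprefers e.1 e.2 w' else true].
pose Q := [set f in M2 | if wpartner M1 f.2 is Some m' then wprefers f.2 f.1 m' else true].
(* An edge of [P] does not block [M2] although its man would gain, so its woman has a strictly
   better partner in [M2]. [QP] is the same argument with the sexes exchanged. *)
have PQ : [set e.2 | e in P] \subset [set f.2 | f in Q].
  apply/subsetP => _ /imsetP[[m w] /[!inE] /andP[mw pr] ->] /=.
  have ac := h1.1 _ _ mw.
  have := nd1 _ mw; rewrite /blocking /= ac /=.
  move: pr => /= pr; rewrite pr /=.
  case E: (wpartner M2 w) => [m'|] // npr.
  move/(wpartnerP _ _ h2): E => m'w.
  have nm : m' != m.
    apply: contraTN pr => /eqP E; move: m'w; rewrite E => /(mpartnerP _ _ h2) ->.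
    by rewrite /mprefers ltnn.
  apply/imsetP; exists (m', w) => //; rewrite inE m'w /=.
  rewrite (elimT (wpartnerP _ _ h1) mw); move: npr; rewrite /wprefers -leqNgt leq_eqVlt.
  case/orP => // /eqP e; case/andP: (h2.1 _ _ m'w) => _ ml.
  by have := index_neq ml nm; rewrite e eqxx.
have QP : [set f.1 | f in Q] \subset [set e.1 | e in P].
  apply/subsetP => _ /imsetP[[m w] /[!inE] /andP[mw pr] ->] /=.
  have ac := h2.1 _ _ mw.
  have := nd2 _ mw; rewrite /blocking /= ac /=.
  move: pr => /= pr; rewrite pr andbT /=.
  case E: (mpartner M1 m) => [w'|] // npr.
  move/(mpartnerP _ _ h1): E => mw'.
  have nw : w' != w.
    apply: contraTN pr => /eqP E; move: mw'; rewrite E => /(wpartnerP _ _ h1) ->.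
    by rewrite /wprefers ltnn.
  apply/imsetP; exists (m, w') => //; rewrite inE mw' /=.
  rewrite (elimT (mpartnerP _ _ h2) mw); move: npr; rewrite /mprefers -leqNgt leq_eqVlt.
  case/orP => // /eqP e; case/andP: (h1.1 _ _ mw') => wl _.
  by have := index_neq wl nw; rewrite e eqxx.
have cP1 : #|[set e.1 | e in P]| = #|P|.
  apply: card_in_imset => -[m w] [m' w'] /[!inE] /andP[a _] /andP[b _] /= e.
  by move: b; rewrite -e => b; rewrite (matching_fst h1 a b).
have cP2 : #|[set e.2 | e in P]| = #|P|.
  apply: card_in_imset => -[m w] [m' w'] /[!inE] /andP[a _] /andP[b _] /= e.
  by move: b; rewrite -e => b; rewrite (matching_snd h1 a b).
have cQ1 : #|[set e.1 | e in Q]| = #|Q|.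
  apply: card_in_imset => -[m w] [m' w'] /[!inE] /andP[a _] /andP[b _] /= e.
  by move: b; rewrite -e => b; rewrite (matching_fst h2 a b).
have cQ2 : #|[set e.2 | e in Q]| = #|Q|.
  apply: card_in_imset => -[m w] [m' w'] /[!inE] /andP[a _] /andP[b _] /= e.
  by move: b; rewrite -e => b; rewrite (matching_snd h2 a b).
(* Projections are injective on a matching, so the inclusions give [#|P| <= #|Q| <= #|P|] and are
   equalities. A man matched in [M1] only would lie on an edge of [P], hence on one of [Q], which is
   in [M2]. *)
have l1 := subset_leq_card PQ; have l2 := subset_leq_card QP.
have eQP : [set f.1 | f in Q] = [set e.1 | e in P].
  by apply/eqP; rewrite eqEcard QP; lia.
have ePQ : [set e.2 | e in P] = [set f.2 | f in Q].
  by apply/eqP; rewrite eqEcard PQ; lia.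
split=> m w mw; apply/eqP => E.
  have : m \in [set e.1 | e in P] by apply/imsetP; exists (m, w); rewrite // inE mw /= E.
  rewrite -eQP => /imsetP[[m' w'] /[!inE] /andP[a _] /= e].
  by move: a; rewrite -e => /(mpartnerP _ _ h2); rewrite E.
have : w \in [set f.2 | f in Q] by apply/imsetP; exists (m, w); rewrite // inE mw /= E.
rewrite -ePQ => /imsetP[[m' w'] /[!inE] /andP[a _] /= e].
by move: a; rewrite -e => /(wpartnerP _ _ h1); rewrite E.
Qed.

Lemma stable_up_to_feasible D M1 M2 :
  stable_up_to D M1 -> stable_up_to D M2 -> feasible M1 -> feasible M2.
Proof.
move=> s1 s2 [h1 fm fw].
have [c1 _] := stable_up_to_covers s1 s2; have [_ c2] := stable_up_to_covers s2 s1.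
split; first by case: s2.
  move=> m /fm; case E: (mpartner M1 m) => [w|//] _.
  by apply: (c1 _ w); apply/(mpartnerP _ _ h1).
move=> w /fw; case E: (wpartner M1 w) => [m|//] _.
by apply: (c2 m); apply/(wpartnerP _ _ h1).
Qed.

Lemma card_bigcup_const (J T : finType) (P : {set J}) (A : J -> {set T}) b :
  (forall i, i \in P -> #|A i| <= b) -> #|\bigcup_(i in P) A i| <= b * #|P|.
Proof.
move=> le; rewrite mulnC -sum_nat_const.
apply: (big_ind2 (fun (X : {set T}) y => #|X| <= y)) => //; first by rewrite cards0.
by move=> x1 x2 y1 y2 l1 l2; apply: leq_trans (leq_card_setU _ _) (leq_add l1 l2).
Qed.

Definition deletion_bound := (DeltaM I - 1) * #|wstar I| + (DeltaW I - 1) * #|mstar I|.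

(* Isolating the partners in [F] of the distinguished persons forces every
   stable matching of the remaining instance to cover these persons. *)
Lemma feasible_deletion F : feasible F ->
  exists2 D : {set edge I}, (forall e : edge I, e \in D -> acceptable e.1 e.2) /\ #|D| <= deletion_bound
    & forall M, stable_up_to D M -> feasible M.
Proof.
move=> [h fm fw].
(* The edges at the partner of [w] in [F], except the one to [w] itself. They come from one list
   with one entry removed, which is the origin of the [- 1] in the exponent. *)
pose D1 w := [set e : edge I | [&& acceptable e.1 e.2, (e.1, w) \in F & e.2 != w]].
pose D2 m := [set e : edge I | [&& acceptable e.1 e.2, (m, e.2) \in F & e.1 != m]].
exists (\bigcup_(w in wstar I) D1 w :|: \bigcup_(m in mstar I) D2 m); first split.
- by move=> e /setUP[|] /bigcupP[x _]; rewrite inE => /andP[].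
- apply: leq_trans (leq_card_setU _ _) (leq_add _ _); apply: card_bigcup_const.
    move=> w /fw; case E: (wpartner F w) => [m|//] _.
    move/(wpartnerP _ _ h): E => mw; have /andP[wl _] := h.1 _ _ mw.
    have s : D1 w \subset [set (m, w') | w' in rem w (mlist m)].
      apply/subsetP => -[m' w'] /[!inE] /= /and3P[ac m'w ne].
      have E := matching_snd h m'w mw; subst m'.
      apply/imsetP; exists w' => //; rewrite mem_rem_uniq ?mlist_uniq // !inE ne /=.
      by case/andP: ac.
    apply: leq_trans (subset_leq_card s) _; apply: leq_trans (leq_imset_card _ _) _.
    apply: leq_trans (card_size _) _; rewrite size_rem // -subn1 leq_sub2r //.
    exact: (leq_bigmax m).
  move=> m /fm; case E: (mpartner F m) => [w|//] _.
  move/(mpartnerP _ _ h): E => mw; have /andP[_ ml] := h.1 _ _ mw.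
  have s : D2 m \subset [set (m', w) | m' in rem m (wlist w)].
    apply/subsetP => -[m' w'] /[!inE] /= /and3P[ac mw' ne].
    have E := matching_fst h mw' mw; subst w'.
    apply/imsetP; exists m' => //; rewrite mem_rem_uniq ?wlist_uniq // !inE ne /=.
    by case/andP: ac.
  apply: leq_trans (subset_leq_card s) _; apply: leq_trans (leq_imset_card _ _) _.
  apply: leq_trans (card_size _) _; rewrite size_rem // -subn1 leq_sub2r //.
  exact: (leq_bigmax w).
move=> M [hM dM bM].
(* No edge of the matching [F] is deleted: a deleted edge shares an endpoint with a different edge
   of [F]. So an edge of [F] cannot be among the blocking pairs of [M]. *)
have nF m w : (m, w) \in F -> ~~ blocking M m w.
  move=> mw; apply/negP => bl.
  have /setUP[|] := subsetP bM (m, w) (ltac:(by rewrite inE)) => /bigcupP[x _];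
    rewrite inE /= => /and3P[_ xF ne].
    by rewrite (matching_fst h mw xF) eqxx in ne.
  by rewrite (matching_snd h mw xF) eqxx in ne.
split=> //.
  move=> m ms; have := fm _ ms; case E: (mpartner F m) => [w|//] _.
  (* If [m] were unmatched in [M], then [w] would need a partner in [M] to keep [(m, w)] from
     blocking; but all other edges at [w] are deleted. *)
  move/(mpartnerP _ _ h): E => mw; apply/eqP => E.
  have := nF _ _ mw; rewrite /blocking (h.1 _ _ mw) E /=.
  case E': (wpartner M w) => [m'|//] _; move/(wpartnerP _ _ hM): E' => m'w.
  have := disjointFr dM m'w; rewrite inE => /norP[_] /negP[].
  apply/bigcupP; exists m => //; rewrite inE /= mw (hM.1 _ _ m'w) /=.
  by apply: contraTneq m'w => ->; apply/(mpartnerP _ _ hM); rewrite E.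
move=> w ws; have := fw _ ws; case E: (wpartner F w) => [m|//] _.
move/(wpartnerP _ _ h): E => mw; apply/eqP => E.
have := nF _ _ mw; rewrite /blocking (h.1 _ _ mw) E /= andbT.
case E': (mpartner M m) => [w'|//] _; move/(mpartnerP _ _ hM): E' => mw'.
have := disjointFr dM mw'; rewrite inE => /norP[] /negP[].
apply/bigcupP; exists w => //; rewrite inE /= mw (hM.1 _ _ mw') /=.
by apply: contraTneq mw' => ->; apply/(wpartnerP _ _ hM); rewrite E.
Qed.

End Stability.

(** * Structured programs with arrays *)

(** Arrays are separate functions selected by a static number, so writes to different arrays never
    interfere and no reasoning about addresses enters the verification of the algorithm. *)
Inductive hexpr :=
| Cst of nat
| Var of nat
| Plus of hexpr & hexpr
| Minus of hexpr & hexpr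
| Get of nat & hexpr.

Inductive htest := HLt of hexpr & hexpr | HEq of hexpr & hexpr.

Inductive hcmd :=
| HSkip
| HSet of nat & hexpr
| HPut of nat & hexpr & hexpr
| HSeq of hcmd & hcmd
| HIf of htest & hcmd & hcmd
| HWhile of htest & hcmd.

Record hstate := HState { var : nat -> nat; arr : nat -> nat -> nat }.

Definition upda (f : nat -> nat -> nat) (k i v : nat) : nat -> nat -> nat :=
  fun k' => if k' == k then upd (f k) i v else f k'.

Fixpoint heval (e : hexpr) (s : hstate) : nat :=
  match e with
  | Cst n => n
  | Var x => var s x
  | Plus e1 e2 => heval e1 s + heval e2 s
  | Minus e1 e2 => heval e1 s - heval e2 s
  | Get k e => arr s k (heval e s)
  end.

Definition hholds (b : htest) (s : hstate) : bool :=
  match b with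
  | HLt e1 e2 => heval e1 s < heval e2 s
  | HEq e1 e2 => heval e1 s == heval e2 s
  end.

(* Only sums can leave the range of words: constants are checked statically by
   [wf_expr], and all other values are already stored. *)
Fixpoint esafe (B : nat) (e : hexpr) (s : hstate) : Prop :=
  match e with
  | Cst _ | Var _ => True
  | Plus e1 e2 => [/\ esafe B e1 s, esafe B e2 s & heval e1 s + heval e2 s < B]
  | Minus e1 e2 => esafe B e1 s /\ esafe B e2 s
  | Get _ e => esafe B e s
  end.

Definition tsafe B (b : htest) s :=
  match b with HLt e1 e2 | HEq e1 e2 => esafe B e1 s /\ esafe B e2 s end.

Definition hset s x v := HState (upd (var s) x v) (arr s).
Definition hput s k i v := HState (var s) (upda (arr s) k i v).

Inductive hexec (B : nat) : hcmd -> hstate -> hstate -> nat -> Prop :=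
| HExecSkip s : hexec B HSkip s s 1
| HExecSet x e s : esafe B e s -> hexec B (HSet x e) s (hset s x (heval e s)) 1
| HExecPut k e1 e2 s : esafe B e1 s -> esafe B e2 s ->
    hexec B (HPut k e1 e2) s (hput s k (heval e1 s) (heval e2 s)) 1
| HExecSeq p q s1 s2 s3 t u :
    hexec B p s1 s2 t -> hexec B q s2 s3 u -> hexec B (HSeq p q) s1 s3 (t + u)
| HExecIf b p q s s' t : tsafe B b s ->
    hexec B (if hholds b s then p else q) s s' t -> hexec B (HIf b p q) s s' t.+1
| HExecWhileTrue b p s1 s2 s3 t u : tsafe B b s1 ->
    hholds b s1 -> hexec B p s1 s2 t -> hexec B (HWhile b p) s2 s3 u ->
    hexec B (HWhile b p) s1 s3 (t + u).+1
| HExecWhileFalse b p s : tsafe B b s ->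
    ~~ hholds b s -> hexec B (HWhile b p) s s 1.

Fixpoint wvars p :=
  match p with
  | HSet x _ => [:: x]
  | HSeq p q | HIf _ p q => wvars p ++ wvars q
  | HWhile _ p => wvars p
  | _ => [::]
  end.

Fixpoint warrs p :=
  match p with
  | HPut k _ _ => [:: k]
  | HSeq p q | HIf _ p q => warrs p ++ warrs q
  | HWhile _ p => warrs p
  | _ => [::]
  end.

(** What a program does not mention syntactically as a target is preserved. Proved once for all
    executions, this lets a specification speak only of what the program changes. *)
Definition frame p s s' :=
  (forall x, x \notin wvars p -> var s' x = var s x) /\
  (forall k, k \notin warrs p -> arr s' k = arr s k).

Lemma frame_refl p s : frame p s s. Proof. by []. Qed.

Lemma frame_trans p s1 s2 s3 : frame p s1 s2 -> frame p s2 s3 -> frame p s1 s3.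
Proof.
by move=> [v1 a1] [v2 a2]; split=> x xp; rewrite (v2, a2) // (v1, a1).
Qed.

Lemma hexec_frame B p s s' t : hexec B p s s' t -> frame p s s'.
Proof.
elim=> {p s s' t} //.
- move=> x e s _; split=> // y; rewrite inE /= /upd => /negbTE -> //.
- move=> k e1 e2 s _ _; split=> // y; rewrite inE /= /upda => /negbTE -> //.
- move=> p q s1 s2 s3 t u _ [v1 a1] _ [v2 a2].
  by split=> x; rewrite mem_cat => /norP[xp xq]; rewrite (v2, a2) // (v1, a1).
- move=> b p q s s' t _ _ [v a]; split=> x; rewrite mem_cat => /norP[xp xq].
    by apply: v; case: hholds.
  by apply: a; case: hholds.
- by move=> b p s1 s2 s3 t u _ _ _ f1 _ f2; apply: frame_trans f1 f2.
Qed.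

Definition hrun B p s T (Q : hstate -> Prop) :=
  exists s' t, [/\ hexec B p s s' t, t <= T & Q s'].

Lemma hrun_weaken B p s T T' (Q Q' : hstate -> Prop) :
  hrun B p s T Q -> T <= T' -> (forall s', frame p s s' -> Q s' -> Q' s') ->
  hrun B p s T' Q'.
Proof.
move=> [s' [t [ex le q]]] lT QQ; exists s', t; split=> //; first exact: leq_trans lT.
by apply: QQ q; apply: hexec_frame ex.
Qed.

Lemma hrun_seq B p q s T T' Q R :
  hrun B p s T R -> (forall s', frame p s s' -> R s' -> hrun B q s' T' Q) ->
  hrun B (HSeq p q) s (T + T') Q.
Proof.
move=> [s1 [t [ex le r]]] h.
have [s2 [u [ex2 le2 qq]]] := h _ (hexec_frame ex) r.
by exists s2, (t + u); split=> //; [apply: HExecSeq ex ex2|apply: leq_add].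
Qed.

Lemma hrun_if B b p q s T Q : tsafe B b s ->
  hrun B (if hholds b s then p else q) s T Q -> hrun B (HIf b p q) s T.+1 Q.
Proof.
by move=> bs [s' [t [ex le qq]]]; exists s', t.+1; split=> //; apply: HExecIf.
Qed.

(** [k] is at once a parameter of the invariant and a variant: it drops in every round, so it bounds
    the number of rounds. Each round pays [c] for the body and one for the test, and the last test
    costs one more. *)
Lemma hrun_while B b p s0 c k0 (Inv : nat -> hstate -> Prop) :
  Inv k0 s0 -> (forall k s, Inv k s -> frame p s0 s -> tsafe B b s) ->
  (forall k s, Inv k s -> frame p s0 s -> hholds b s ->
     hrun B p s c (fun s' => exists2 k', k' < k & Inv k' s')) ->
  hrun B (HWhile b p) s0 (k0 * c.+1).+1
    (fun s' => ~~ hholds b s' /\ exists k, Inv k s').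
Proof.
move=> i0 sf st; have fr0 : frame p s0 s0 by exact: frame_refl.
suff H s : frame p s0 s -> Inv k0 s ->
  hrun B (HWhile b p) s (k0 * c.+1).+1 (fun s' => ~~ hholds b s' /\ exists k, Inv k s').
  exact: H.
elim/ltn_ind: k0 s {i0 fr0} => k0 IH s fr i0.
case hb: (hholds b s); last first.
  exists s, 1; split=> //; last by split; [rewrite hb | exists k0].
  by apply: HExecWhileFalse; rewrite ?hb //; apply: sf i0 fr.
have [s1 [t [ex le [k1 lk i1]]]] := st _ _ i0 fr hb.
have [|s2 [u [ex2 le2 q]]] := IH k1 lk s1 _ i1.
  exact: frame_trans fr (hexec_frame ex).
exists s2, (t + u).+1; split=> //.
  by apply: HExecWhileTrue ex ex2 => //; apply: sf i0 fr.
rewrite ltnS; apply: leq_trans (leq_add le le2) _.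
have : k1.+1 * c.+1 <= k0 * c.+1 by rewrite leq_mul2r lk orbT.
by rewrite mulSn; lia.
Qed.

(** Symbolic execution of loop-free programs by computation. The value on [HWhile] is a default,
    excluded by [hsafe]. *)
Fixpoint hdo p s :=
  match p with
  | HSkip | HWhile _ _ => s
  | HSet x e => hset s x (heval e s)
  | HPut k e1 e2 => hput s k (heval e1 s) (heval e2 s)
  | HSeq p q => hdo q (hdo p s)
  | HIf b p q => if hholds b s then hdo p s else hdo q s
  end.

Fixpoint hsafe B p s : Prop :=
  match p with
  | HSkip => True
  | HWhile _ _ => False
  | HSet x e => esafe B e s
  | HPut k e1 e2 => esafe B e1 s /\ esafe B e2 s
  | HSeq p q => hsafe B p s /\ hsafe B q (hdo p s)
  | HIf b p q => tsafe B b s /\ if hholds b s then hsafe B p s else hsafe B q s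
  end.

Fixpoint hcost p :=
  match p with
  | HSkip | HWhile _ _ | HSet _ _ | HPut _ _ _ => 1
  | HSeq p q => hcost p + hcost q
  | HIf _ p q => (maxn (hcost p) (hcost q)).+1
  end.

Lemma hrun_do B p s (Q : hstate -> Prop) :
  hsafe B p s -> Q (hdo p s) -> hrun B p s (hcost p) Q.
Proof.
elim: p s Q => [|x e|k e1 e2|p IHp q IHq|b p IHp q IHq|//] s Q /=.
- by move=> _ q; exists s, 1; split=> //; constructor.
- by move=> sf q; eexists; exists 1; split; [constructor| |exact: q].
- by move=> [sf1 sf2] q; eexists; exists 1; split; [constructor| |exact: q].
- move=> [sp sq] qq; apply: (@hrun_seq _ _ _ _ _ _ _ (eq (hdo p s))).
    exact: IHp.
  by move=> _ _ <-; apply: IHq.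
- move=> [sb sf] qq; apply: hrun_if => //; case: hholds sf qq => sf qq.
    by apply: hrun_weaken (IHp _ _ sf qq) _ _ => //; apply: leq_maxl.
  by apply: hrun_weaken (IHq _ _ sf qq) _ _ => //; apply: leq_maxr.
Qed.

(* Variable [x] lives in register [2 x], temporary [d] in register [2 d + 1],
   and entry [i] of array [k < 16] in cell [16 i + k]. *)
Local Notation tmp d := (d.*2.+1).

(** * Compilation of structured programs to the machine *)

Fixpoint wf_expr e :=
  match e with
  | Cst n => n < 16
  | Var _ => true
  | Plus e1 e2 | Minus e1 e2 => wf_expr e1 && wf_expr e2
  | Get k e => (k < 16) && wf_expr e
  end.

Definition wf_test b :=
  match b with HLt e1 e2 | HEq e1 e2 => wf_expr e1 && wf_expr e2 end.

Fixpoint wf p :=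
  match p with
  | HSkip => true
  | HSet _ e => wf_expr e
  | HPut k e1 e2 => [&& k < 16, wf_expr e1 & wf_expr e2]
  | HSeq p q => wf p && wf q
  | HIf b p q => [&& wf_test b, wf p & wf q]
  | HWhile b p => wf_test b && wf p
  end.

Definition dbl d := Assign (tmp d) (Add (tmp d) (tmp d)).

(** Four doublings stand for the multiplication by 16, which the machine lacks. *)
Definition address k d :=
  Seq (Seq (Seq (dbl d) (dbl d)) (Seq (dbl d) (dbl d)))
      (Seq (Assign (tmp d.+1) (Const k)) (Assign (tmp d) (Add (tmp d) (tmp d.+1)))).

(** The temporaries form an evaluation stack of height [d]: the value is left in temporary [d], and
    those below [d], which hold pending operands, are preserved. *)
Fixpoint comp_expr e d :=
  match e with
  | Cst n => Assign (tmp d) (Const n)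
  | Var x => Assign (tmp d) (Reg x.*2)
  | Plus e1 e2 => Seq (Seq (comp_expr e1 d) (comp_expr e2 d.+1))
                      (Assign (tmp d) (Add (tmp d) (tmp d.+1)))
  | Minus e1 e2 => Seq (Seq (comp_expr e1 d) (comp_expr e2 d.+1))
                       (Assign (tmp d) (Defs.Sub (tmp d) (tmp d.+1)))
  | Get k e => Seq (Seq (comp_expr e d) (address k d)) (Assign (tmp d) (Read (tmp d)))
  end.

Fixpoint expr_cost e :=
  match e with
  | Cst _ | Var _ => 1
  | Plus e1 e2 | Minus e1 e2 => expr_cost e1 + expr_cost e2 + 1
  | Get _ e => expr_cost e + 6 + 1
  end.

Definition comp_args e1 e2 := Seq (comp_expr e1 0) (comp_expr e2 1).

Definition comp_test b := match b with HLt e1 e2 | HEq e1 e2 => comp_args e1 e2 end.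

Definition test_of b :=
  match b with HLt _ _ => Lt (tmp 0) (tmp 1) | HEq _ _ => Eq (tmp 0) (tmp 1) end.

Definition test_cost b :=
  match b with HLt e1 e2 | HEq e1 e2 => expr_cost e1 + expr_cost e2 end.

(** Machine tests only compare registers, so the operands of a loop test are evaluated before the
    loop and again at the end of each round. *)
Fixpoint comp p :=
  match p with
  | HSkip => Skip
  | HSet x e => Seq (comp_expr e 0) (Assign x.*2 (Reg (tmp 0)))
  | HPut k e1 e2 =>
      Seq (Seq (Seq (comp_expr e1 0) (address k 0)) (comp_expr e2 1)) (Write (tmp 0) (tmp 1))
  | HSeq p q => Seq (comp p) (comp q)
  | HIf b p q => Seq (comp_test b) (If (test_of b) (comp p) (comp q))
  | HWhile b p =>
      Seq (comp_test b) (While (test_of b) (Seq (comp p) (comp_test b)))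
  end.

(** A slowdown factor that depends on the program text only, so it can enter the constant of the
    final bound. *)
Fixpoint comp_cost p :=
  match p with
  | HSkip => 1
  | HSet _ e => expr_cost e + 1
  | HPut _ e1 e2 => expr_cost e1 + 6 + expr_cost e2 + 1
  | HSeq p q => comp_cost p + comp_cost q
  | HIf b p q => test_cost b + comp_cost p + comp_cost q + 1
  | HWhile b p => test_cost b + comp_cost p + 1
  end.

Section Simulation.
(** [B'] bounds the words of the source program and [B] those of the machine. The gap leaves room
    for the addresses [16 * i + k], and 16 words cover the constants and array numbers. *)
Variables B' B : nat.
Hypothesis B'_ge : 16 <= B'.
Hypothesis B_ge : 16 * B' + 16 <= B.

Record sim (s : state) (h : hstate) : Prop := Sim {
  sim_var : forall x, reg s x.*2 = var h x;
  sim_arr : forall k i, k < 16 -> Defs.mem s (16 * i + k) = arr h k i;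
  sim_var_lt : forall x, var h x < B';
  sim_arr_lt : forall k i, arr h k i < B'
}.

Definition keeps d (s s' : state) := forall x, x < d -> reg s' (tmp x) = reg s (tmp x).

Lemma exec_address k d s : k < 16 -> reg s (tmp d) < B' ->
  exists s', [/\ exec B (address k d) s s' 6, Defs.mem s' = Defs.mem s,
     reg s' (tmp d) = 16 * reg s (tmp d) + k,
     (forall x, reg s' x.*2 = reg s x.*2) & keeps d s s'].
Proof.
move=> k16 lt; eexists; split.
- apply: (@ExecSeq _ _ _ _ _ _ 4 2).
    apply: (@ExecSeq _ _ _ _ _ _ 2 2); apply: (@ExecSeq _ _ _ _ _ _ 1 1); constructor;
    rewrite /= /upd ?eqxx /=; lia.
  apply: (@ExecSeq _ _ _ _ _ _ 1 1); constructor; rewrite /= /upd ?eqxx /=; first lia.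
  by do ?[case: eqP => ?]; lia.
- by [].
- by rewrite /= /upd ?eqxx /=; do ?[case: eqP => ?]; lia.
- by move=> x; rewrite /= /upd; do ?[case: eqP => ?]; lia.
- by move=> x lx; rewrite /= /upd; do ?[case: eqP => ?]; lia.
Qed.

Lemma heval_lt e s h : sim s h -> wf_expr e -> esafe B' e h -> heval e h < B'.
Proof.
move=> sm; elim: e => [n|x|e1 IH1 e2 IH2|e1 IH1 e2 IH2|k e IH] /=.
- by move=> h1 _; apply: leq_trans h1 B'_ge.
- by move=> _ _; apply: sim_var_lt sm _.
- by move=> _ [].
- by move=> /andP[w1 w2] [s1 s2]; apply: leq_ltn_trans (leq_subr _ _) (IH1 w1 s1).
- by move=> _ _; apply: sim_arr_lt sm _ _.
Qed.

Lemma sim_ext s s' h : sim s h -> Defs.mem s' = Defs.mem s ->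
  (forall x, reg s' x.*2 = reg s x.*2) -> sim s' h.
Proof. by case=> a b c d em er; split=> // [x|k i k16]; rewrite ?er ?em // b. Qed.

Lemma exec_comp_expr e d s h : sim s h -> wf_expr e -> esafe B' e h ->
  exists s', [/\ exec B (comp_expr e d) s s' (expr_cost e), sim s' h,
    reg s' (tmp d) = heval e h, Defs.mem s' = Defs.mem s & keeps d s s'].
Proof.
elim: e d s => [n|x|e1 IH1 e2 IH2|e1 IH1 e2 IH2|k e IH] d s sm wfe sf /=.
- eexists; split; first by constructor; move: wfe => /=; lia.
  + by apply: sim_ext sm _ _ => //= x; rewrite /upd; case: ifP => //; lia.
  + by rewrite /= /upd eqxx.
  + by [].
  + by move=> x lx; rewrite /= /upd; case: ifP => //; lia.
- eexists; split.
  + by constructor; rewrite /= (sim_var sm); have := sim_var_lt sm x; lia.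
  + by apply: sim_ext sm _ _ => //= y; rewrite /upd; case: ifP => //; lia.
  + by rewrite /= /upd eqxx (sim_var sm).
  + by [].
  + by move=> y ly; rewrite /= /upd; case: ifP => //; lia.
- move: wfe sf => /= /andP[w1 w2] [sf1 sf2 lt].
  have [s1 [x1 sm1 r1 m1 k1]] := IH1 d _ sm w1 sf1.
  have [s2 [x2 sm2 r2 m2 k2]] := IH2 d.+1 _ sm1 w2 sf2.
  have r1' : reg s2 (tmp d) = heval e1 h by rewrite k2.
  eexists; split.
  + apply: ExecSeq (ExecSeq x1 x2) _; constructor; rewrite /= r1' r2; lia.
  + by apply: sim_ext sm2 _ _ => //= x; rewrite /upd; case: ifP => //; lia.
  + by rewrite /= /upd eqxx r1' r2.
  + by rewrite /= m2.
  + move=> x lx; rewrite /= /upd; case: ifP; first lia.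
    by move=> _; rewrite k2 ?k1 //; lia.
- move: wfe sf => /= /andP[w1 w2] [sf1 sf2].
  have [s1 [x1 sm1 r1 m1 k1]] := IH1 d _ sm w1 sf1.
  have [s2 [x2 sm2 r2 m2 k2]] := IH2 d.+1 _ sm1 w2 sf2.
  have r1' : reg s2 (tmp d) = heval e1 h by rewrite k2.
  have l1 := heval_lt sm w1 sf1.
  eexists; split.
  + apply: ExecSeq (ExecSeq x1 x2) _; constructor; rewrite /= r1' r2; lia.
  + by apply: sim_ext sm2 _ _ => //= x; rewrite /upd; case: ifP => //; lia.
  + by rewrite /= /upd eqxx r1' r2.
  + by rewrite /= m2.
  + move=> x lx; rewrite /= /upd; case: ifP; first lia.
    by move=> _; rewrite k2 ?k1 //; lia.
- move: wfe sf => /= /andP[wk we] sf.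
  have [s1 [x1 sm1 r1 m1 k1]] := IH d _ sm we sf.
  have [|s2 [x2 m2 r2 e2 k2]] := @exec_address k d s1 wk; first by rewrite r1 (heval_lt sm).
  have v : Defs.mem s2 (reg s2 (tmp d)) = arr h k (heval e h).
    by rewrite r2 m2 r1 (sim_arr sm1).
  eexists; split.
  + apply: ExecSeq (ExecSeq x1 x2) _; constructor; rewrite /= v.
    by have := sim_arr_lt sm k (heval e h); lia.
  + apply: sim_ext sm1 _ _ => //= x; rewrite /upd; case: ifP => //; lia.
  + by rewrite /= /upd eqxx v.
  + by rewrite /= m2.
  + move=> x lx; rewrite /= /upd; case: ifP; first lia.
    by move=> _; rewrite k2 ?k1 //; lia.
Qed.

Lemma exec_comp_args e1 e2 s h : sim s h -> wf_expr e1 -> wf_expr e2 ->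
  esafe B' e1 h -> esafe B' e2 h ->
  exists s', [/\ exec B (comp_args e1 e2) s s' (expr_cost e1 + expr_cost e2), sim s' h,
    reg s' (tmp 0) = heval e1 h & reg s' (tmp 1) = heval e2 h].
Proof.
move=> sm w1 w2 sf1 sf2.
have [s1 [x1 sm1 r1 _ k1]] := exec_comp_expr 0 sm w1 sf1.
have [s2 [x2 sm2 r2 _ k2]] := exec_comp_expr 1 sm1 w2 sf2.
by exists s2; split=> //; [apply: ExecSeq x1 x2|rewrite k2].
Qed.

Lemma exec_comp_test b s h : sim s h -> wf_test b -> tsafe B' b h ->
  exists s', [/\ exec B (comp_test b) s s' (test_cost b), sim s' h &
    holds (test_of b) s' = hholds b h].
Proof.
move=> sm; case: b => e1 e2 /= /andP[w1 w2] [sf1 sf2];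
have [s' [x sm' r1 r2]] := exec_comp_args sm w1 w2 sf1 sf2;
by exists s'; rewrite -r1 -r2.
Qed.

Lemma exec_comp p h h' t s : hexec B' p h h' t -> wf p -> sim s h ->
  exists s' t', [/\ exec B (comp p) s s' t', t' <= comp_cost p * t & sim s' h'].
Proof.
move=> ex; elim: ex s => {p h h' t} /=.
- by move=> h s _ sm; exists s, 1; split=> //; constructor.
- move=> x e h sf s wfe sm; have [s1 [x1 sm1 r1 m1 _]] := exec_comp_expr 0 sm wfe sf.
  have lt := heval_lt sm wfe sf.
  exists (State (upd (reg s1) x.*2 (heval e h)) (Defs.mem s1)), (expr_cost e + 1).
  split; last 1 first.
  + split=> /=; first by move=> y; rewrite /upd (inj_eq double_inj); case: ifP => _ //;
      apply: sim_var sm1 _.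
    * by move=> k i k16; apply: sim_arr sm1 _ _ _.
    * by move=> y; rewrite /upd; case: ifP => _ //; apply: sim_var_lt sm _.
    * exact: sim_arr_lt sm.
  + apply: ExecSeq x1 _; rewrite -r1.
    by have := @ExecAssign B x.*2 (Reg (tmp 0)) s1; apply => /=; rewrite r1; lia.
  + by rewrite muln1.
- move=> k e1 e2 h sf1 sf2 s /and3P[wk w1 w2] sm.
  have [s1 [x1 sm1 r1 m1 k1]] := exec_comp_expr 0 sm w1 sf1.
  have l1 := heval_lt sm w1 sf1; have l2 := heval_lt sm w2 sf2.
  have [|s2 [x2 m2 r2 e2' k2]] := @exec_address k 0 s1 wk; first by rewrite r1.
  have sm2 := sim_ext sm1 m2 e2'.
  have [s3 [x3 sm3 r3 m3 k3]] := exec_comp_expr 1 sm2 w2 sf2.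
  have r0 : reg s3 (tmp 0) = 16 * heval e1 h + k by rewrite k3 // r2 r1.
  eexists; eexists; split.
  + exact: ExecSeq (ExecSeq (ExecSeq x1 x2) x3) (ExecWrite _ _ _ _).
  + by rewrite muln1.
  + split=> /=.
    * exact: sim_var sm3.
    * move=> k' i k16; rewrite r0 r3 /upda /upd.
      case: (eqVneq k' k) => [->|ne].
        by rewrite eqn_add2r eqn_mul2l /=; case: eqP => // _; apply: sim_arr sm3 _ _ _.
      have -> : (16 * i + k' == 16 * heval e1 h + k) = false.
        by apply/negbTE/eqP => E; case/eqP: ne; move: E k16 wk; lia.
      exact: sim_arr sm3 _ _ _.
    * exact: sim_var_lt sm.
    * move=> k' i; rewrite /upda /upd; case: ifP => _; last exact: sim_arr_lt sm _ _.
      by case: ifP => _ //; apply: sim_arr_lt sm _ _.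
- move=> p q h1 h2 h3 t u _ IH1 _ IH2 s /andP[wp wq] sm.
  have [s1 [t1 [x1 l1 sm1]]] := IH1 _ wp sm.
  have [s2 [t2 [x2 l2 sm2]]] := IH2 _ wq sm1.
  exists s2, (t1 + t2); split=> //; first exact: ExecSeq x1 x2.
  by nia.
- move=> b p q h h' t bs _ IH s /and3P[wb wp wq] sm.
  have [s1 [x1 sm1 hb]] := exec_comp_test sm wb bs.
  case E: (hholds b h) IH hb => IH hb.
    have [s2 [t2 [x2 l2 sm2]]] := IH _ wp sm1.
    exists s2, (test_cost b + t2.+1); split=> //; last by nia.
    by apply: ExecSeq x1 _; apply: ExecIfTrue.
  have [s2 [t2 [x2 l2 sm2]]] := IH _ wq sm1.
  exists s2, (test_cost b + t2.+1); split=> //; last by nia.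
  by apply: ExecSeq x1 _; apply: ExecIfFalse; rewrite ?hb.
- move=> b p h1 h2 h3 t u bs hb _ IH1 _ IH2 s /andP[wb wp] sm.
  have [s1 [x1 sm1 hb1]] := exec_comp_test sm wb bs.
  have [s2 [t2 [x2 l2 sm2]]] := IH1 _ wp sm1.
  have [|s3 [t3 [x3 l3 sm3]]] := IH2 s2 _ sm2; first by rewrite wb.
  (* The run given by induction for the rest of the loop begins with an evaluation of the test. Cut
     off there, this evaluation becomes the end of the current round. *)
  inversion x3 as [| | |? ? ? s4 ? ta tb xa xb| | | |]; subst.
  exists s3, (test_cost b + ((t2 + ta) + tb).+1); split=> //; last by nia.
  apply: ExecSeq x1 _; apply: ExecWhileTrue xb; first by rewrite hb1.
  exact: ExecSeq x2 xa.
- move=> b p h bs hb s /andP[wb wp] sm.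
  have [s1 [x1 sm1 hb1]] := exec_comp_test sm wb bs.
  exists s1, (test_cost b + 1); split=> //; last by rewrite muln1; lia.
  by apply: ExecSeq x1 _; apply: ExecWhileFalse; rewrite hb1.
Qed.

End Simulation.

(** * Moving the input to and the output from array layout *)

Definition run B p s T (Q : state -> Prop) :=
  exists s' t, [/\ exec B p s s' t, t <= T & Q s'].

Lemma run_seq B p q s T T' Q R :
  run B p s T R -> (forall s', R s' -> run B q s' T' Q) -> run B (Seq p q) s (T + T') Q.
Proof.
move=> [s1 [t [ex le r]]] h; have [s2 [u [ex2 le2 qq]]] := h _ r.
by exists s2, (t + u); split=> //; [apply: ExecSeq ex ex2|apply: leq_add].
Qed.

Lemma run_while B b p s c k (Inv : nat -> state -> Prop) : Inv k s ->
  (forall k s, Inv k s -> holds b s ->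
     run B p s c (fun s' => exists2 k', k' < k & Inv k' s')) ->
  run B (While b p) s (k * c.+1).+1 (fun s' => ~~ holds b s' /\ exists k, Inv k s').
Proof.
move=> i0 st; elim/ltn_ind: k s i0 => k IH s i0.
case hb: (holds b s); last first.
  exists s, 1; split=> //; last by split; [rewrite hb | exists k].
  by apply: ExecWhileFalse; rewrite ?hb.
have [s1 [t [ex le [k1 lk i1]]]] := st _ _ i0 hb.
have [s2 [u [ex2 le2 q]]] := IH k1 lk s1 i1.
exists s2, (t + u).+1; split=> //; first exact: ExecWhileTrue ex ex2.
rewrite ltnS; apply: leq_trans (leq_add le le2) _.
have : k1.+1 * c.+1 <= k * c.+1 by rewrite leq_mul2r lk orbT.
by rewrite mulSn; lia.
Qed.

Fixpoint block_do p s :=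
  match p with
  | Assign x e => State (upd (reg s) x (eval e s)) (Defs.mem s)
  | Write a v => State (reg s) (upd (Defs.mem s) (reg s a) (reg s v))
  | Seq p q => block_do q (block_do p s)
  | _ => s
  end.

Fixpoint block_safe B p s : Prop :=
  match p with
  | Assign x e => eval e s < B
  | Write a v => True
  | Seq p q => block_safe B p s /\ block_safe B q (block_do p s)
  | _ => False
  end.

Fixpoint block_cost p := if p is Seq p q then block_cost p + block_cost q else 1.

Lemma run_block B p s (Q : state -> Prop) :
  block_safe B p s -> Q (block_do p s) -> run B p s (block_cost p) Q.
Proof.
elim: p s Q => [//|x e|a v|p IHp q IHq|//|//] s Q /=.
- by move=> sf q; eexists; exists 1; split; [constructor| |exact: q].
- by move=> _ q; eexists; exists 1; split; [constructor| |exact: q].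
- move=> [sp sq] qq; apply: (@run_seq _ _ _ _ _ _ _ (eq (block_do p s))).
    exact: IHp.
  by move=> _ <-; apply: IHq.
Qed.

(** The machine is not told the input length; it is found by hopping over the persons, each of whom
    states the length of the list. Only odd registers serve as scratch, because the even ones become
    variables that must start at 0. Register 13 is never written and supplies the constant 0. *)
Definition measure_input : cmd :=
  Seq (Seq (Seq (Assign 5 (Const 1)) (Assign 9 (Read 13)))
           (Seq (Assign 11 (Read 5)) (Assign 3 (Add 9 11))))
      (Seq (Assign 7 (Const 2)) (Assign 1 (Const 2))).

Definition measure_step : cmd :=
  Seq (Seq (Assign 9 (Add 1 5)) (Assign 9 (Read 9)))
      (Seq (Seq (Assign 1 (Add 1 9)) (Assign 1 (Add 1 7))) (Assign 3 (Defs.Sub 3 5))).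

(* The cells are visited downwards, so that cell [16 i] is overwritten after
   it has been moved. *)
Definition spread_step : cmd :=
  Seq (Seq (Seq (Assign 1 (Defs.Sub 1 5)) (Assign 9 (Read 1)))
           (Seq (Write 1 13) (Assign 11 (Add 1 1))))
      (Seq (Seq (Assign 11 (Add 11 11)) (Assign 11 (Add 11 11)))
           (Seq (Assign 11 (Add 11 11)) (Write 11 9))).

Definition load_input : cmd :=
  Seq (Seq measure_input (While (Lt 13 3) measure_step))
      (Seq (Assign 0 (Reg 1)) (While (Lt 13 1) spread_step)).

Definition loaded (input : seq nat) : hstate :=
  HState (fun x => if x == 0 then size input else 0)
         (fun k i => if k == 0 then nth 0 input i else 0).

(** Stated for any input made of two header cells, whose sum is the number [P] of blocks, and of
    blocks starting at the positions [S i]. *)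
Lemma run_load_input B' B (input : seq nat) (S : nat -> nat) (P : nat) :
  16 <= B' -> 16 * B' + 16 <= B -> size input < B' ->
  (forall i, nth 0 input i < B') ->
  P = nth 0 input 0 + nth 0 input 1 -> P <= size input ->
  S 0 = 2 -> S P = size input -> (forall i, i <= P -> S i <= size input) ->
  (forall i, i < P -> S i.+1 = S i + nth 0 input (S i + 1) + 2) ->
  run B load_input (init_state input) (6 + (size input * 6).+1 + (1 + (size input * 9).+1))
    (fun s => sim B' s (loaded input)).
Proof.
move=> B16 Bge ltN ltI EP lP S0 SP leS SS.
set N := size input in ltN lP SP leS *.
set inp := nth 0 input in ltI EP SS *.
have i0 := ltI 0; have i1 := ltI 1.
pose base s := [/\ forall x, odd x = false -> reg s x = 0, reg s 5 = 1, reg s 7 = 2,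
   reg s 13 = 0 & Defs.mem s = inp].
apply: (@run_seq _ _ _ _ _ _ _ (fun s => base s /\ reg s 1 = N)).
  apply: (@run_seq _ _ _ _ _ _ _ (fun s => [/\ base s, reg s 1 = 2 & reg s 3 = P])).
    have := @run_block B measure_input (init_state input); apply.
      by rewrite /= /upd /= -/(inp 0) -/(inp 1); do ?split; lia.
    rewrite /= /upd /=; split=> //; split=> // x; move: x; do 14?[case=> //].
  move=> s1 [bs r1 r3].
  have := @run_while B (Lt 13 3) measure_step s1 5 P
    (fun k s => [/\ base s, k <= P, reg s 1 = S (P - k) & reg s 3 = k]).
  case.
  - by rewrite subnn S0 r1.
  - move=> k s [[e0 e5 e7 e13 em] kP e1 e3] /=; rewrite e13 e3 => k0.
    have -> : 5 = block_cost measure_step by [].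
    have le1 := leS (P - k) (leq_subr _ _).
    have lt : P - k < P by lia.
    have SSk := SS _ lt.
    have le2 := leS (P - k).+1 lt.
    have lv := ltI (S (P - k) + 1).
    apply: run_block; rewrite /= /upd /= ?em ?e1 ?e5 ?e7 ?e3.
      by do ?split; rewrite ?em; lia.
    exists k.-1; first by lia.
    split=> /=; last 3 first.
    + by lia.
    + have -> : P - k.-1 = (P - k).+1 by lia.
      by rewrite SSk.
    + by lia.
    by split=> //= x ox; rewrite ?em; do ?[case: eqP => [E|_]; first by rewrite E in ox]; apply: e0.
  - move=> s' [t [ex le [nh [k [b' kP e1 e3]]]]].
    exists s', t; split=> //.
      apply: leq_trans le _; rewrite ltnS leq_mul2r lP orbT //.
    split=> //; move: nh => /=; case: b' => _ _ _ -> _; rewrite e3 e1.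
    by case: k {kP e1 e3} => // _; rewrite subn0.
move=> s1 [[e0 e5 e7 e13 em] e1].
pose reg0 s := reg s 0 = N /\ forall x, reg s x.+1.*2 = 0.
apply: (@run_seq _ _ _ _ _ _ _
  (fun s => [/\ reg0 s, reg s 5 = 1, reg s 13 = 0, Defs.mem s = inp & reg s 1 = N])).
  have := @run_block B (Assign 0 (Reg 1)) s1; apply=> /=; first by rewrite e1; lia.
  split=> //; split=> /= [|x]; rewrite /upd /= ?e1 //.
  by rewrite e0 //; rewrite odd_double.
move=> s2 [r0 r5 r13 rm r1].
(* With [k] cells still to move, the cells below [k] are untouched, the entries from [k] on sit at
   their multiples of 16, and every other cell from [k] on is 0, as the empty arrays require. *)
have := @run_while B (Lt 13 1) spread_step s2 8 N
  (fun k s => [/\ reg0 s, reg s 5 = 1, reg s 13 = 0 & [/\ k <= N, reg s 1 = k,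
    (forall a, a < k -> Defs.mem s a = inp a),
    (forall j, k <= j -> Defs.mem s (16 * j) = inp j) &
    (forall a, k <= a -> (a %% 16 != 0) || (a %/ 16 < k) -> Defs.mem s a = 0)]]).
case.
- split=> //; split=> //; rewrite ?rm // /inp => j lj; first by rewrite !nth_default //; lia.
  by move=> _; rewrite nth_default.
- move=> k s [[q0 qe] q5 q13 [kN q1 qlo qin qhi]] /=; rewrite q13 q1 => k0.
  have -> : 8 = block_cost spread_step by [].
  have vk : Defs.mem s k.-1 = inp k.-1 by apply: qlo; lia.
  have lv := ltI k.-1.
  apply: run_block; rewrite /= /upd /= ?q1 ?q5 ?subn1 ?q13.
    by do ?split; rewrite ?vk; lia.
  exists k.-1; first by lia.
  have a16 : k.-1 + k.-1 + (k.-1 + k.-1) + (k.-1 + k.-1 + (k.-1 + k.-1)) +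
    (k.-1 + k.-1 + (k.-1 + k.-1) + (k.-1 + k.-1 + (k.-1 + k.-1))) = 16 * k.-1 by lia.
  rewrite a16 vk; split=> //=.
    split=> //= x.
    by do ?[case: eqP => [?|_]; first lia]; apply: qe.
  split=> //=; first by lia.
  + move=> a la; case: eqP => [E|ne]; first lia.
    by case: eqP => [|_]; [lia|apply: qlo; lia].
  + move=> j lj; rewrite eqn_mul2l /=; case: eqP => [-> //|ne].
    case: eqP => [|_]; first by lia.
    by apply: qin; lia.
  + move=> a la h; case: eqP => [E|ne]; first by exfalso; move: h; rewrite E modnMr mulKn //; lia.
    by case: eqP => // ne2; apply: qhi; first lia; case/orP: h => h; apply/orP; [left|right]; lia.
- move=> s' [t [ex le [nh [k [[q0 qe] q5 q13 [kN q1 qlo qin qhi]]]]]].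
  have k0 : k = 0 by move: nh; rewrite /= q13 q1; case: (k).
  move: qin qhi; rewrite k0 => qin qhi; exists s', t; split=> //; split.
  + by case=> [|x] //=; rewrite qe.
  + move=> k' i k16 /=; case: eqP => [->|/eqP kn]; first by rewrite addn0 qin.
    by apply: qhi => //; apply/orP; left; rewrite mulnC modnMDl modn_small.
  + by move=> x /=; case: ifP => // _; lia.
  + by move=> k' i /=; case: ifP => // _; lia.
Qed.

(** Copying upwards is safe here: cell [i] lies below every cell [16 * j + 1] with [i <= j] that is
    still to be read. *)
Definition store_step : cmd :=
  Seq (Seq (Seq (Assign 3 (Add 1 1)) (Assign 3 (Add 3 3)))
           (Seq (Assign 3 (Add 3 3)) (Assign 3 (Add 3 3))))
      (Seq (Seq (Assign 3 (Add 3 5)) (Assign 7 (Read 3)))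
           (Seq (Write 1 7) (Assign 1 (Add 1 5)))).

Definition store_output : cmd :=
  Seq (Seq (Assign 1 (Const 0)) (Assign 5 (Const 1))) (While (Lt 1 0) store_step).

Lemma run_store_output B' B s h : 16 <= B' -> 16 * B' + 16 <= B -> sim B' s h ->
  run B store_output s (2 + (var h 0 * 9).+1)
    (fun s' => forall i, i < var h 0 -> Defs.mem s' i = arr h 1 i).
Proof.
move=> B16 Bge sm; have lL := sim_var_lt sm 0.
have r0 : reg s 0 = var h 0 by apply: (sim_var sm 0).
apply: (@run_seq _ _ _ _ _ _ _ (fun s' =>
   [/\ reg s' 0 = var h 0, reg s' 1 = 0, reg s' 5 = 1 & Defs.mem s' = Defs.mem s])).
  have := @run_block B (Seq (Assign 1 (Const 0)) (Assign 5 (Const 1))) s; apply.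
    by rewrite /=; lia.
  by rewrite /= /upd /=.
move=> s1 [q0 q1 q5 qm].
have := @run_while B (Lt 1 0) store_step s1 8 (var h 0)
  (fun k s' => [/\ reg s' 0 = var h 0, reg s' 5 = 1, k <= var h 0 & [/\ reg s' 1 = var h 0 - k,
     forall i, i < var h 0 - k -> Defs.mem s' i = arr h 1 i &
     forall a, var h 0 - k <= a -> Defs.mem s' a = Defs.mem s a]]).
case.
- by rewrite subnn qm.
- move=> k s' [p0 p5 kL [p1 plo phi]] /=; rewrite p0 p1 => lt.
  have -> : 8 = block_cost store_step by [].
  set i := var h 0 - k in p1 plo phi lt *.
  have a16 : i + i + (i + i) + (i + i + (i + i)) +
    (i + i + (i + i) + (i + i + (i + i))) + 1 = 16 * i + 1 by lia.
  have vi : Defs.mem s' (16 * i + 1) = arr h 1 i.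
    by rewrite phi ?(sim_arr sm) //; lia.
  have lv := sim_arr_lt sm 1 i.
  apply: run_block; rewrite /= /upd /= ?p1 ?p5 ?a16 ?vi.
    by do ?split; lia.
  exists k.-1; first by lia.
  split=> //; first lia; have E : var h 0 - k.-1 = i.+1 by lia.
  split=> /=; rewrite ?E ?addn1 //.
    by move=> j; rewrite ltnS leq_eqVlt; case: eqP => [->|_] //= /plo.
  by move=> a la; case: eqP => [|_]; [lia|apply: phi; lia].
- move=> s' [t [ex le [nh [k [p0 p5 kL [p1 plo phi]]]]]].
  exists s', t; split=> // i li; apply: plo.
  by move: nh; rewrite /= p0 p1 -leqNgt => /(leq_trans li).
Qed.

(** * Codes of edge sets and the layout of the input *)

Lemma nth_flatten_sumn (T : Type) (x0 : T) (ss : seq (seq T)) i j :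
  j < size (nth [::] ss i) ->
  nth x0 (flatten ss) (sumn (take i (shape ss)) + j) = nth x0 (nth [::] ss i) j.
Proof.
elim: ss i => [|s ss IH] [|i] //= lt; first by rewrite nth_cat add0n lt.
by rewrite nth_cat -addnA ltnNge leq_addr /= addKn IH.
Qed.

Lemma nth_map_enum_ord (T : Type) (x0 : T) k (f : 'I_k -> T) (i : 'I_k) :
  nth x0 [seq f j | j <- enum 'I_k] i = f i.
Proof. by rewrite (nth_map i) ?size_enum_ord // nth_ord_enum. Qed.

(** * Digits in base N and their increment *)

Section Digits.
Variable N : nat.
Hypothesis N_gt1 : 1 < N.

Definition digit v j := v %/ N ^ j %% N.

Lemma digit_lt v j : digit v j < N. Proof. by rewrite ltn_mod ltnW. Qed.

Lemma digit_small v l j : v < N ^ l -> l <= j -> digit v j = 0.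
Proof.
move=> lt lj; rewrite /digit divn_small ?mod0n //.
by apply: leq_trans lt _; rewrite leq_exp2l.
Qed.

Lemma digit_cons p v j : p < N -> digit (p + N * v) j = if j is j'.+1 then digit v j' else p.
Proof.
move=> lt; case: j => [|j]; rewrite /digit.
  by rewrite expn0 divn1 [N * v]mulnC [p + _]addnC modnMDl modn_small.
by rewrite expnS divnMA [N * v]mulnC [p + _]addnC divnMDl ?(ltnW N_gt1) // (divn_small lt) addn0.
Qed.

Lemma code_of_seq (s : seq nat) : all (fun p => p < N) s ->
  exists2 v, v < N ^ size s & forall j, digit v j = nth 0 s j.
Proof.
elim: s => [_|p s IH /= /andP[lp /IH[v lv dv]]].
  by exists 0 => // j; rewrite nth_nil /digit div0n mod0n.
exists (p + N * v); last by move=> [|j]; rewrite digit_cons //= dv.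
rewrite expnS; have : N * v.+1 <= N * N ^ size s by rewrite leq_mul2l lv orbT.
by rewrite mulnS; lia.
Qed.

(** [N ^ j] divides [v.+1] exactly when the [j] lowest digits of [v] are all [N - 1], that is, when
    the carry reaches position [j]. This divisibility is the invariant of the carry loop. *)
Lemma digit_carry v j : N ^ j %| v.+1 ->
  (N ^ j.+1 %| v.+1) = ((digit v j).+1 == N).
Proof.
have j0 : 0 < N ^ j by rewrite expn_gt0 ltnW.
move=> /dvdnP[k Ek]; have k0 : 0 < k by case: k Ek.
have Ev : v = k.-1 * N ^ j + (N ^ j).-1 by nia.
rewrite /digit {2}Ev divnMDl // divn_small ?addn0; last by lia.
rewrite Ek expnSr [k * _]mulnC dvdn_pmul2l //.
rewrite -{1}(prednK k0) {1}(divn_eq k.-1 N) -addnS dvdn_addr ?dvdn_mull //.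
apply/idP/eqP => [/dvdn_leq le|->]; last by [].
by have := ltn_pmod k.-1 (ltnW N_gt1); have := le isT; lia.
Qed.

Lemma digit_succ v j i : N ^ j %| v.+1 -> (digit v j).+1 != N ->
  digit v.+1 i = if i < j then 0 else if i == j then (digit v j).+1 else digit v i.
Proof.
have j0 : 0 < N ^ j by rewrite expn_gt0 ltnW.
move=> /dvdnP[k Ek] ne; have k0 : 0 < k by case: k Ek.
have Ev : v = k.-1 * N ^ j + (N ^ j).-1 by nia.
have vj : v %/ N ^ j = k.-1 by rewrite {1}Ev divnMDl // divn_small ?addn0 //; lia.
have vj1 : v.+1 %/ N ^ j = k by rewrite Ek mulnK.
have lt : k.-1 %% N < N.-1.
  by have := digit_lt v j; move: ne; rewrite /digit vj => /eqP ne lt; lia.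
have lt2 : (k.-1 %% N).+1 < N by move: lt; move: (k.-1 %% N) => x; lia.
have kq : k = k.-1 %/ N * N + (k.-1 %% N).+1 by rewrite addnS -divn_eq prednK.
case: ltnP => [ij|ji].
  rewrite /digit Ek -(subnKC (ltnW ij)) expnD [N ^ i * _]mulnC mulnA mulnK ?expn_gt0 ?(ltnW N_gt1) //.
  have -> : j - i = (j - i).-1.+1 by lia.
  by rewrite expnSr mulnA modnMl.
case: eqP => [->|/eqP ne2].
  by rewrite /digit vj vj1 {1}kq modnMDl modn_small.
have -> : i = j + (i - j).-1.+1 by lia.
rewrite /digit expnD !divnMA vj vj1 expnS !divnMA {1}kq divnMDl ?(ltnW N_gt1) //.
by rewrite (divn_small lt2) addn0.
Qed.

End Digits.

(** * Positions in the encoded instance and codes of edge sets *)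

Section Encoding.
Variable I : smc.
Local Notation n := (nmen I).
Local Notation q := (nwomen I).
Local Notation N := (isize I).

Definition inp := nth 0 (encode_smc I).

(** Men and women share one numbering, woman [w] being person [n + w], so that loops over all
    persons need no case for the sexes. *)
Definition persons : seq (seq nat) :=
  [seq encode_person (m \in mstar I) (mlist m) | m <- enum 'I_n] ++
  [seq encode_person (w \in wstar I) (wlist w) | w <- enum 'I_q].

Definition start i := 2 + sumn (take i (shape persons)).
Definition plist i := drop 2 (nth [::] persons i).
Definition star i := nth 0 (nth [::] persons i) 0.

Lemma encode_smcE : encode_smc I = [:: n, q & flatten persons].
Proof. by rewrite /encode_smc /persons flatten_cat. Qed.

Lemma size_persons : size persons = n + q.
Proof. by rewrite size_cat 2!size_map !size_enum_ord. Qed.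

Lemma person_man (m : 'I_n) : nth [::] persons m = encode_person (m \in mstar I) (mlist m).
Proof. by rewrite nth_cat size_map size_enum_ord ltn_ord nth_map_enum_ord. Qed.

Lemma person_woman (w : 'I_q) :
  nth [::] persons (n + w) = encode_person (w \in wstar I) (wlist w).
Proof.
by rewrite nth_cat size_map size_enum_ord ltnNge leq_addr /= addKn nth_map_enum_ord.
Qed.

Lemma plist_man (m : 'I_n) : plist m = [seq val w | w <- mlist m].
Proof. by rewrite /plist person_man /= drop0. Qed.

Lemma plist_woman (w : 'I_q) : plist (n + w) = [seq val m | m <- wlist w].
Proof. by rewrite /plist person_woman /= drop0. Qed.

Lemma star_man (m : 'I_n) : star m = (m \in mstar I).
Proof. by rewrite /star person_man. Qed.

Lemma star_woman (w : 'I_q) : star (n + w) = (w \in wstar I).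
Proof. by rewrite /star person_woman. Qed.

Variant person_spec : nat -> Type :=
| PersonMan (m : 'I_n) : person_spec m
| PersonWoman (w : 'I_q) : person_spec (n + w).

Lemma personP i : i < n + q -> person_spec i.
Proof.
case: (ltnP i n) => [lt _|le lt]; first exact: (PersonMan (Ordinal lt)).
have lt2 : i - n < q by lia.
by rewrite -(subnKC le); apply: (PersonWoman (Ordinal lt2)).
Qed.

Lemma personE i : i < n + q -> nth [::] persons i = [:: star i, size (plist i) & plist i].
Proof.
by case/personP => [m|w]; rewrite /star /plist ?person_man ?person_woman /= drop0 size_map.
Qed.

Lemma startS i : i < n + q -> start i.+1 = start i + size (plist i) + 2.
Proof.
move=> lt; rewrite /start (take_nth 0) ?size_map ?size_persons //.
rewrite sumn_rcons (nth_map [::]) ?size_persons // personE //=; lia.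
Qed.

Lemma start0 : start 0 = 2. Proof. by rewrite /start take0. Qed.

Lemma start_end : start (n + q) = N.
Proof.
by rewrite /start /isize encode_smcE /= take_oversize ?size_map ?size_persons // size_flatten.
Qed.

Lemma inp_person i j : j < size (nth [::] persons i) ->
  inp (start i + j) = nth 0 (nth [::] persons i) j.
Proof.
by move=> lt; rewrite /inp encode_smcE /start -addnA /= nth_flatten_sumn.
Qed.

Lemma inp_star i : i < n + q -> inp (start i) = star i.
Proof. by move=> lt; rewrite -[start i]addn0 inp_person personE. Qed.

Lemma inp_size i : i < n + q -> inp (start i + 1) = size (plist i).
Proof. by move=> lt; rewrite inp_person personE. Qed.

Lemma inp_plist i j : i < n + q -> j < size (plist i) ->
  inp (start i + 2 + j) = nth 0 (plist i) j.
Proof. by move=> lt lj; rewrite -addnA inp_person personE. Qed.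

Lemma inp0 : inp 0 = n. Proof. by rewrite /inp encode_smcE. Qed.
Lemma inp1 : inp 1 = q. Proof. by rewrite /inp encode_smcE. Qed.

Lemma start_mono i j : i <= j -> j <= n + q -> start i + 2 * (j - i) <= start j.
Proof.
elim: j => [|j IH]; first by rewrite leqn0 => /eqP -> _; rewrite muln0 addn0.
rewrite leq_eqVlt => /orP[/eqP -> _|lt le]; first by rewrite subnn muln0 addn0.
by rewrite startS //; have := IH lt (ltnW le); lia.
Qed.

Lemma start_le i : i <= n + q -> start i <= N.
Proof. by move=> le; have := start_mono le (leqnn _); rewrite start_end; lia. Qed.

Lemma size_persons_lt : 2 * (n + q) + 2 <= N.
Proof. by have := start_mono (leq0n (n + q)) (leqnn _); rewrite start_end start0; lia. Qed.

Lemma start_inj i j p : i < n + q -> j < n + q ->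
  start i <= p < start i.+1 -> start j <= p < start j.+1 -> i = j.
Proof.
move=> li lj /andP[a b] /andP[c d].
case: (ltngtP i j) => // lt.
  by have := @start_mono i.+1 j lt (ltnW lj); lia.
by have := @start_mono j.+1 i lt (ltnW li); lia.
Qed.

Lemma plist_size_lt i : i < n + q -> size (plist i) + 4 <= N.
Proof. by move=> lt; have := start_le lt; rewrite startS // /start; lia. Qed.

Lemma plist_le i p : i < n + q -> p \in plist i -> p < if i < n then q else n.
Proof.
case/personP => [m|w]; first by rewrite plist_man ltn_ord => /mapP[w _ ->]; apply: ltn_ord.
by rewrite plist_woman [n + w < n]ltnNge leq_addr => /mapP[m _ ->]; apply: ltn_ord.
Qed.

Lemma plist_uniq i : i < n + q -> uniq (plist i).
Proof.
by case/personP => [m|w]; rewrite ?plist_man ?plist_woman map_inj_uniq ?mlist_uniq ?wlist_uniq //;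
  apply: val_inj.
Qed.

Lemma star_le i : i < n + q -> star i <= 1.
Proof. by case/personP => [m|w]; rewrite ?star_man ?star_woman; case: (_ \in _). Qed.

Lemma inp_le i : inp i <= N.
Proof.
have sz := size_persons_lt.
case: (ltnP i N) => [lt|le]; last by rewrite /inp nth_default.
have : inp i \in encode_smc I by apply: mem_nth.
rewrite encode_smcE !inE => /or3P[/eqP -> |/eqP -> |]; try by lia.
case/flattenP => s /(nthP [::])[j]; rewrite size_persons => lj <-.
rewrite personE // !inE => /or3P[/eqP -> |/eqP -> |]; first by have := star_le lj; lia.
  by have := plist_size_lt lj; lia.
by move=> /(plist_le lj); case: ifP; lia.
Qed.

Lemma inp_range i p : i < n + q -> start i + 2 <= p < start i.+1 ->
  inp p \in plist i /\ p = start i + 2 + index (inp p) (plist i).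
Proof.
move=> li /andP[a b]; rewrite startS // in b.
have lj : p - (start i + 2) < size (plist i) by lia.
have Ep : p = start i + 2 + (p - (start i + 2)) by lia.
have Ei : inp p = nth 0 (plist i) (p - (start i + 2)) by rewrite {1}Ep inp_plist.
by rewrite Ei mem_nth // index_uniq ?plist_uniq.
Qed.

(* A woman's rank of a man is his position in the input, or 0 if she does not
   list him. *)
Definition rank w m :=
  if m \in plist (n + w) then start (n + w) + 2 + index m (plist (n + w)) else 0.

Lemma rankP w m : w < q -> rank w m != 0 ->
  [/\ start (n + w) + 2 <= rank w m < start (n + w).+1, inp (rank w m) = m & m < n].
Proof.
move=> lw; rewrite /rank; case: ifP => // mw _.
have li : n + w < n + q by rewrite ltn_add2l.
have lx : index m (plist (n + w)) < size (plist (n + w)) by rewrite index_mem.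
split; first by rewrite startS //; lia.
  by rewrite inp_plist // nth_index.
by have := plist_le li mw; rewrite [n + w < n]ltnNge leq_addr.
Qed.

Lemma rank_lt w m : w < q -> rank w m < N.
Proof.
move=> lw; case: (eqVneq (rank w m) 0) => [->|/(rankP lw)[/andP[_ lt] _ _]].
  by have := size_persons_lt; lia.
by apply: leq_trans lt (start_le _); lia.
Qed.

Lemma rank_at w p : w < q -> start (n + w) + 2 <= p < start (n + w).+1 ->
  rank w (inp p) = p.
Proof.
move=> lw /inp_range[|mem {2}->]; first by lia.
by rewrite /rank mem.
Qed.

Lemma rank_ord (w : 'I_q) (m : 'I_n) : rank w m =
  if m \in wlist w then start (n + w) + 2 + index m (wlist w) else 0.
Proof.
rewrite /rank plist_woman (mem_map val_inj); case: ifP => // _.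
by rewrite (index_map val_inj).
Qed.

(** An edge is named by its cell in the list of the man. For acceptable edges this is a nonzero
    number below [N], so it fits in one digit and 0 remains free for padding. *)
Definition epos (e : edge I) := start e.1 + 2 + index e.2 (mlist e.1).

Lemma epos_range (m : 'I_n) (w : 'I_q) : w \in mlist m ->
  start m + 2 <= epos (m, w) < start m.+1.
Proof.
rewrite -index_mem => lt; rewrite startS; last by have := ltn_ord m; lia.
by rewrite plist_man size_map /epos /= leq_addr [start m + size _ + 2]addnAC ltn_add2l.
Qed.

Lemma inp_epos (m : 'I_n) (w : 'I_q) : w \in mlist m -> inp (epos (m, w)) = w.
Proof.
move=> wl; have lm : m < n + q by have := ltn_ord m; lia.
have lt : index w (mlist m) < size (plist m) by rewrite plist_man size_map index_mem.
by rewrite /epos /= inp_plist // plist_man (nth_map w) ?index_mem // nth_index.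
Qed.

Lemma epos_at (m : 'I_n) p : start m + 2 <= p < start m.+1 ->
  exists2 w : 'I_q, w \in mlist m & p = epos (m, w) /\ inp p = w.
Proof.
move=> /inp_range[|]; first by have := ltn_ord m; lia.
rewrite plist_man => /mapP[w wl E] Ep; exists w => //; split=> //.
by rewrite Ep E (index_map val_inj).
Qed.

Lemma epos_lt (e : edge I) : acceptable e.1 e.2 -> 0 < epos e < N.
Proof.
case: e => m w /= /andP[wl _]; have /andP[a b] := epos_range wl.
have lm : m.+1 <= n + q by have := ltn_ord m; lia.
by have := start_le lm; lia.
Qed.

Lemma epos_inj (e f : edge I) :
  acceptable e.1 e.2 -> acceptable f.1 f.2 -> epos e = epos f -> e = f.
Proof.
case: e f => [m w] [m' w'] /= /andP[wl _] /andP[wl' _] E.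
have em : m = m'.
  apply: val_inj; apply: (@start_inj _ _ (epos (m, w))) => /=.
  - by have := ltn_ord m; lia.
  - by have := ltn_ord m'; lia.
  - by have := epos_range wl; lia.
  - by rewrite E; have := epos_range wl'; lia.
subst m'; congr (_, _); apply: val_inj.
by rewrite /= -(inp_epos wl) -(inp_epos wl') E.
Qed.

(** The cap by [N] keeps the deletion loop linear. It loses no edge set, as there are at most [N]
    acceptable edges. *)
Definition width := minn (deletion_bound I) N.

(* A set of edges is coded by a number [v]: each of its [width] lowest digits in
   base [N] designates the input cell of a deleted list entry; cells that are not
   in the list of a man, such as cell 0, designate nothing. *)
Definition marked v p := [exists j : 'I_width, digit N v j == p].

Definition deleted v : {set edge I} :=
  [set e : edge I | acceptable e.1 e.2 && marked v (epos e)].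

Lemma N_gt1 : 1 < N. Proof. by have := size_persons_lt; lia. Qed.

(** The digits from position [l] on are 0, and no acceptable edge sits at cell 0. *)
Lemma card_deleted v l : v < N ^ l -> #|deleted v| <= l.
Proof.
move=> lt; rewrite cardE -(size_map epos) -(size_mkseq (digit N v) l).
apply: uniq_leq_size.
  rewrite map_inj_in_uniq ?enum_uniq // => e f.
  by rewrite !mem_enum !inE => /andP[ae _] /andP[af _]; apply: epos_inj.
move=> _ /mapP[e /[!mem_enum] /[!inE] /andP[ac /existsP[j /eqP dj]] ->].
apply/mapP; exists (val j) => //; rewrite mem_iota /=.
case: (ltnP j l) => // le; have := epos_lt ac.
by rewrite -dj (digit_small N_gt1 lt le).
Qed.

Lemma code_of_deletion (D : {set edge I}) :
  (forall e, e \in D -> acceptable e.1 e.2) -> #|D| <= width ->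
  exists2 v, v < N ^ #|D| & deleted v = D.
Proof.
move=> ac le.
have [|v lv dv] := @code_of_seq _ N_gt1 (map epos (enum D)).
  by apply/allP => _ /mapP[e /[!mem_enum] /ac /epos_lt /andP[_ lt] ->].
rewrite size_map -cardE in lv; exists v => //; apply/setP => e; rewrite inE.
apply/andP/idP => [[ae /existsP[j /eqP]]|eD].
  rewrite dv => dj; have pe := epos_lt ae.
  have lj : j < size (enum D).
    rewrite -(size_map epos) ltnNge; apply/negP => ge.
    by rewrite -dj nth_default in pe.
  have : epos e \in map epos (enum D) by rewrite -dj mem_nth ?size_map.
  move=> /mapP[f /[!mem_enum] fD ef].
  by rewrite (epos_inj ae (ac _ fD) ef).
split; first exact: ac.
have eD' : e \in enum D by rewrite mem_enum.
have lj : index e (enum D) < width by apply: leq_trans le; rewrite cardE index_mem.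
apply/existsP; exists (Ordinal lj); rewrite dv (nth_map e) ?index_mem //.
by rewrite nth_index.
Qed.

Lemma acceptable_card (D : {set edge I}) :
  (forall e, e \in D -> acceptable e.1 e.2) -> #|D| <= N.
Proof.
move=> ac; rewrite cardE -(size_map epos) -(size_iota 0 N); apply: uniq_leq_size.
  rewrite map_inj_in_uniq ?enum_uniq // => e f.
  by rewrite !mem_enum => /ac ae /ac af; apply: epos_inj.
by move=> _ /mapP[e /[!mem_enum] /ac /epos_lt lt ->]; rewrite mem_iota; lia.
Qed.

(** One infeasible witness is enough: by [stable_up_to_feasible], no other matching stable up to the
    same deletions is feasible. *)
Definition refuted v := exists2 M, stable_up_to (deleted v) M & ~ feasible M.

Lemma all_refuted_infeasible :
  (forall v, v < N ^ width -> refuted v) -> forall M : {set edge I}, ~ feasible M.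
Proof.
move=> ref F fF; have [D [ac le] good] := feasible_deletion fF.
have leD : #|D| <= width by rewrite leq_min le acceptable_card.
have [v lv dv] := code_of_deletion ac leD.
have [|M] := ref v; last by rewrite dv => /good.
by apply: leq_trans lv _; rewrite leq_exp2l // N_gt1.
Qed.

(* The codes are tried in increasing order, hence by increasing number of
   significant digits, which bounds the number of deleted edges. *)
Lemma first_unrefuted_optimal v (M : {set edge I}) : v < N ^ width ->
  (forall u, u < v -> refuted u) -> stable_up_to (deleted v) M -> feasible M -> optimal M.
Proof.
move=> lv ref sM fM; split=> // F fF; rewrite leqNgt; apply/negP => lt.
have [hF _ _] := fF; have sF := stable_up_to_blocking_pairs hF.
have leM : #|blocking_pairs M| <= #|deleted v| by apply: subset_leq_card; case: sM.
(* [F] is stable once its blocking pairs are deleted. If their code [u] is below [v], it was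
   refuted, against the feasibility of [F]; otherwise [v <= u < N ^ #|blocking_pairs F|] bounds the
   number of edges deleted by [v]. *)
have [||u lu du] := @code_of_deletion (blocking_pairs F).
- by move=> e; rewrite inE => /and3P[].
- by have := card_deleted lv; lia.
case: (ltnP u v) => [/ref[G]|le].
  by rewrite du => sG; apply; apply: stable_up_to_feasible sF sG fF.
by have := card_deleted (leq_ltn_trans le lu); lia.
Qed.

(* Man [m] currently proposes to the entry of his list in input cell [P m]
   (beyond the list once he is rejected by all), and [H w] is the successor of
   the man held by [w], or 0. A cell [p] is deleted if [X p] is larger than all
   ranks. *)
Record gs_done (X P H : nat -> nat) : Prop := GsDone {
  gsd_range m : m < n -> start m + 2 <= P m <= start m.+1;
  gsd_man m : m < n -> P m < start m.+1 ->
    H (inp (P m)) = m.+1 /\ X (P m) < rank (inp (P m)) m;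
  gsd_woman w m : w < q -> H w = m.+1 -> [/\ m < n, P m < start m.+1 & inp (P m) = w];
  gsd_reject m p : m < n -> start m + 2 <= p < P m -> X p < rank (inp p) m ->
    exists2 m', H (inp p) = m'.+1 & rank (inp p) m' <= rank (inp p) m
}.

Definition matching_of P : {set edge I} :=
  [set e : edge I | (P (val e.1) < start e.1.+1) && (inp (P (val e.1)) == e.2)].

(** * Stability of the outcome of the proposals *)

Section Done.
Variables (v : nat) (X P H : nat -> nat).
Hypothesis done : gs_done X P H.
Hypothesis markX : forall p, p < N -> X p = if marked v p then N else 0.

Let in_matching (m : 'I_n) (w : 'I_q) : (m, w) \in matching_of P ->
  [/\ w \in mlist m, m \in wlist w, P m = epos (m, w), H w = m.+1 & X (P m) < rank w m].
Proof.
rewrite inE /= => /andP[lt /eqP E].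
have rg : start m + 2 <= P m < start m.+1 by have := gsd_range done (ltn_ord m); lia.
have [w' wl [Ep Ei]] := epos_at rg.
have ew : w = w' by apply: val_inj; rewrite /= -E.
subst w'; have [h r] := gsd_man done (ltn_ord m) lt; rewrite Ei in h r.
by split=> //; move: r; rewrite rank_ord; case: ifP.
Qed.

Lemma matching_of_matching : is_matching (matching_of P).
Proof.
split=> [m w /in_matching[wl ml _ _ _]|[m w] [m' w'] eM fM ne /=].
  by rewrite /acceptable wl.
have [_ _ P1 H1 _] := in_matching eM; have [_ _ P2 H2 _] := in_matching fM.
split; apply: contra ne => /eqP E; subst.
  move: eM fM; rewrite !inE /= => /andP[_ /eqP E1] /andP[_ /eqP E2].
  by apply/eqP; congr (_, _); apply: val_inj; rewrite /= -E1 -E2.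
by rewrite H1 in H2; case: H2 => E; apply/eqP; congr (_, _); apply: val_inj.
Qed.

Lemma matching_of_stable : stable_up_to (deleted v) (matching_of P).
Proof.
have hM := matching_of_matching.
split=> //.
  rewrite disjoint_subset; apply/subsetP => -[m w] mw; rewrite !inE /=.
  have [wl ml Pe _ r] := in_matching mw; apply/negP => /andP[ac mk].
  have lt := @epos_lt (m, w) ac; move: r; rewrite Pe markX; last by case/andP: lt.
  by rewrite mk; have := @rank_lt w m (ltn_ord _); lia.
suff key (m : 'I_n) (w : 'I_q) : blocking (matching_of P) m w -> marked v (epos (m, w)).
  apply/subsetP => -[m w]; rewrite !inE /= => bl; rewrite (key _ _ bl) andbT.
  by case/and3P: bl.
move=> /and3P[ac bm bw].
case: (boolP (marked v (epos (m, w)))) => // nmk; exfalso.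
have [/andP[wl ml] lt] := (ac, @epos_lt (m, w) ac).
have Xp : X (epos (m, w)) < rank w m.
  by rewrite markX ?(negbTE nmk); [rewrite rank_ord ml | case/andP: lt].
have [re1 re2] := andP (epos_range wl).
(* Preferring [w] to his situation, [m] has already moved past her entry; so she rejected him and
   holds a man at least as good, and the pair does not block. *)
have pP : epos (m, w) < P m.
  have rg := gsd_range done (ltn_ord m).
  case E: (mpartner (matching_of P) m) bm => [w'|] bm; last first.
    case: (ltnP (P m) (start m.+1)) => [lt2|]; last by lia.
    have rg2 : start m + 2 <= P m < start m.+1 by lia.
    have [w' wl' [_ Ei]] := epos_at rg2.
    suff /(mpartnerP _ _ hM) : (m, w') \in matching_of P by rewrite E.
    by rewrite inE /= lt2 Ei eqxx.
  move/(mpartnerP _ _ hM): E => /in_matching[_ _ -> _ _].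
  by rewrite /epos /= ltn_add2l.
have rg : start m + 2 <= epos (m, w) < P m by rewrite re1.
have := gsd_reject done (ltn_ord m) rg; rewrite inp_epos // => /(_ Xp)[m' Hw le].
have [lm' ltP E] := gsd_woman done (ltn_ord w) Hw.
have mw : (Ordinal lm', w) \in matching_of P by rewrite inE /= ltP E eqxx.
move: bw; rewrite (elimT (wpartnerP _ _ hM) mw) /wprefers.
have [_ ml' _ _ _] := in_matching mw.
move=> lt'; move: le; rewrite -[m']/(nat_of_ord (Ordinal lm')) !rank_ord ml ml'.
by rewrite leq_add2l leqNgt lt'.
Qed.

Lemma mpartner_matching_of (m : 'I_n) :
  (if mpartner (matching_of P) m is Some w then (val w).+1 else 0) =
  if P m == start m.+1 then 0 else (inp (P m)).+1.
Proof.
have hM := matching_of_matching; have rg := gsd_range done (ltn_ord m).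
case E: (mpartner _ m) => [w|].
  move/(mpartnerP _ _ hM): E; rewrite inE /= => /andP[lt /eqP ->].
  by case: eqP => //; lia.
case: eqP => // ne.
have rg2 : start m + 2 <= P m < start m.+1 by lia.
have [w wl [_ Ei]] := epos_at rg2.
suff /(mpartnerP _ _ hM) : (m, w) \in matching_of P by rewrite E.
by rewrite inE /= Ei eqxx andbT; lia.
Qed.

Definition covered i :=
  if i < n then P i != start i.+1 else H (i - n) != 0.

Lemma matching_of_feasible :
  feasible (matching_of P) <-> (forall i, i < n + q -> star i != 0 -> covered i).
Proof.
have hM := matching_of_matching.
have cm (m : 'I_n) : (mpartner (matching_of P) m != None) = (P m != start m.+1).
  by have := mpartner_matching_of m; case: (mpartner _ m) => [w|]; case: eqP.
have cw (w : 'I_q) : (wpartner (matching_of P) w != None) = (H w != 0).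
  case E: (wpartner _ w) => [m|].
    by move/(wpartnerP _ _ hM): E => /in_matching[_ _ _ -> _].
  case Hw: (H w) => [|m] //.
  have [lm lt Ei] := gsd_woman done (ltn_ord w) Hw.
  suff /(wpartnerP _ _ hM) : (Ordinal lm, w) \in matching_of P by rewrite E.
  by rewrite inE /= lt Ei eqxx.
split=> [[_ fm fw] i li|all].
  case/personP: li => [m|w]; rewrite /covered.
    by rewrite star_man ltn_ord -cm => sm; apply: fm; move: sm; case: (m \in _).
  rewrite star_woman ltnNge leq_addr addKn /= -cw => sw.
  by apply: fw; move: sw; case: (w \in _).
split=> // [m ms|w ws].
  have := all m; rewrite /covered star_man ms ltn_ord cm; apply=> //.
  by have := ltn_ord m; lia.
have := all (n + w); rewrite /covered star_woman ws [n + w < n]ltnNge leq_addr addKn cw; apply=> //.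
by rewrite ltn_add2l.
Qed.

End Done.

End Encoding.

(** * The proposal algorithm *)

Section GaleShapley.
Variable I : smc.
Local Notation n := (nmen I).
Local Notation q := (nwomen I).
Local Notation N := (isize I).
Local Notation inp := (inp I).
Local Notation start := (start I).
Local Notation rank := (rank I).
Variable X : nat -> nat.

(** A potential: the list entries that the men have not passed yet. Added to the number of men not
    yet settled or proposing for the first time, it drops by one in every step of the algorithm. *)
Definition remaining (P : nat -> nat) := \sum_(j < n) (start j.+1 - P j).

Lemma remaining_upd P m : m < n -> P m < start m.+1 ->
  (remaining (upd P m (P m).+1)).+1 = remaining P.
Proof.
move=> lm lt; rewrite /remaining (bigD1 (Ordinal lm)) //= [RHS](bigD1 (Ordinal lm)) //=.
rewrite /upd eqxx; set a := \sum_(i < n | _) _; set b := \sum_(i < n | _) _.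
have -> : a = b; last by lia.
apply: eq_bigr => j ne; case: eqP => // E; case/negP: ne.
by apply/eqP; apply: val_inj.
Qed.

(* The men up to [m0] other than [m] are settled, i.e. held by a woman or
   rejected by all women; [m] is about to propose. *)
Record gs_inv (m0 m k : nat) (P H : nat -> nat) : Prop := GsInv {
  gsi_m0 : m0 <= n;
  gsi_m : m <= m0;
  gsi_last : n <= m0 -> m = m0;
  gsi_k : n - m0 + remaining P = k;
  gsi_range i : i < n -> start i + 2 <= P i <= start i.+1;
  gsi_man i : i < n -> i <= m0 -> i <> m -> P i < start i.+1 ->
    H (inp (P i)) = i.+1 /\ X (P i) < rank (inp (P i)) i;
  gsi_woman w i : w < q -> H w = i.+1 ->
    [/\ i < n, i <= m0, i <> m, P i < start i.+1 & inp (P i) = w];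
  gsi_reject i p : i < n -> start i + 2 <= p < P i -> X p < rank (inp p) i ->
    exists2 i', H (inp p) = i'.+1 & rank (inp p) i' <= rank (inp p) i
}.

Lemma gs_inv_done m0 m k P H : gs_inv m0 m k P H -> n <= m0 -> gs_done I X P H.
Proof.
move=> [m0n mm0 last _ rg man wom rej] nm0; have e0 : m0 = n by lia.
have em := last nm0; subst m; subst m0; split=> // [i li lt|w i lw Hw]; first by apply: man => //; lia.
by have [] := wom w i lw Hw.
Qed.

Lemma inp_man_lt m p : m < n -> start m + 2 <= p < start m.+1 -> inp p < q.
Proof.
by move=> lm /(@epos_at I (Ordinal lm))[w _ [_ ->]]; apply: ltn_ord.
Qed.

Lemma gs_inv_start P H : (forall i, i < n -> P i = start i + 2) ->
  (forall w, w < q -> H w = 0) -> gs_inv 0 0 (n + remaining P) P H.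
Proof.
move=> P0 H0; split=> //; first by rewrite subn0.
- by move=> i li; rewrite P0 // startS; lia.
- by move=> i li; rewrite leqn0 => /eqP.
- by move=> w i lw; rewrite H0.
- by move=> i p li; rewrite P0 //; lia.
Qed.

Lemma gs_inv_exhausted m0 k P H m : m0 < n -> gs_inv m0 m k P H -> P m = start m.+1 ->
  gs_inv m0.+1 m0.+1 k.-1 P H /\ k.-1 < k.
Proof.
move=> l0 [m0n mm0 last Ek rg man wom rej] EP; split; last by lia.
split=> //; first by lia.
  move=> i li le ne lt; apply: man => //; first by lia.
  by move=> E; move: lt; rewrite E EP ltnn.
move=> w i lw Hw; have [] := wom w i lw Hw; split=> //; lia.
Qed.

(* Both for an unacceptable or deleted entry and for a rejected proposal. *)
Lemma gs_inv_advance m0 k P H m : m0 < n -> gs_inv m0 m k P H -> P m < start m.+1 ->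
  (X (P m) < rank (inp (P m)) m ->
   exists2 h, H (inp (P m)) = h.+1 & rank (inp (P m)) h <= rank (inp (P m)) m) ->
  gs_inv m0 m k.-1 (upd P m (P m).+1) H /\ k.-1 < k.
Proof.
move=> l0 [m0n mm0 last Ek rg man wom rej] lt adv; have lm : m < n by lia.
have rem := remaining_upd lm lt.
split; last by lia.
split=> //; try lia.
- move=> i li; rewrite /upd; case: eqP => [->|_]; last exact: rg.
  by have := rg m lm; lia.
- by move=> i li le ne; rewrite /upd; case: eqP => // _; apply: man.
- by move=> w i lw Hw; have [a b c d e] := wom w i lw Hw; rewrite /upd; case: eqP.
- move=> i p li; rewrite /upd; case: eqP => [->|_]; last exact: rej.
  rewrite ltnS => /andP[a]; rewrite leq_eqVlt => /orP[/eqP ->|b]; first exact: adv.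
  by apply: rej => //; rewrite a.
Qed.

Lemma gs_inv_accept m0 k P H m : m0 < n -> gs_inv m0 m k P H -> P m < start m.+1 ->
  X (P m) < rank (inp (P m)) m -> H (inp (P m)) = 0 ->
  gs_inv m0.+1 m0.+1 k.-1 P (upd H (inp (P m)) m.+1) /\ k.-1 < k.
Proof.
move=> l0 [m0n mm0 last Ek rg man wom rej] lt ok H0; have lm : m < n by lia.
split; last by lia.
split=> //; first by lia.
- move=> i li le ne ltP; rewrite /upd; case: (eqVneq i m) => [->|nm]; first by rewrite eqxx.
  have [|||hi xi] := man i li => //; first by lia.
    by apply/eqP.
  by case: eqP => // E; rewrite E H0 in hi.
- move=> w i lw; rewrite /upd; case: eqP => [-> [<-]|_ Hw]; first by split=> //; lia.
  by have [] := wom w i lw Hw; split=> //; lia.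
- move=> i p li rp xp; have [i' hi' ri'] := rej i p li rp xp; exists i' => //.
  by rewrite /upd; case: eqP => // E; rewrite E H0 in hi'.
Qed.

(** The displaced man becomes the proposer and passes the entry of [w] at once, which pays for the
    step. Earlier rejections by [w] stay justified, since her new partner is better than [h]. *)
Lemma gs_inv_displace m0 k P H m h : m0 < n -> gs_inv m0 m k P H -> P m < start m.+1 ->
  X (P m) < rank (inp (P m)) m -> H (inp (P m)) = h.+1 ->
  rank (inp (P m)) m < rank (inp (P m)) h ->
  gs_inv m0 h k.-1 (upd P h (P h).+1) (upd H (inp (P m)) m.+1) /\ k.-1 < k.
Proof.
move=> l0 [m0n mm0 last Ek rg man wom rej] lt ok Hh better; have lm : m < n by lia.
set w := inp (P m) in ok Hh better *.
have lw : w < q by apply: (@inp_man_lt m) => //; have := rg m lm; lia.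
have [lh lh0 hm ltP hw] := wom w h lw Hh.
have rem := remaining_upd lh ltP.
split; last by lia.
split=> //; try lia.
- move=> i li; rewrite /upd; case: eqP => [->|_]; last exact: rg.
  by have := rg h lh; lia.
- move=> i li le ne; rewrite /upd; case: (eqVneq i h) => // nh ltPi.
  case: (eqVneq i m) => [->|nm]; first by rewrite eqxx.
  have [|||hi xi] := man i li => //; first by apply/eqP.
  case: eqP => // E; move: hi; rewrite E Hh => -[E2].
  by rewrite E2 eqxx in nh.
- move=> w1 i lw1; rewrite /upd; case: eqP => [-> [<-]|nw Hw].
    by case: eqP => [E|_]; [case: hm|split=> //; move=> E; case: hm].
  have [a b c d e] := wom w1 i lw1 Hw.
  case: eqP => [E|ne]; last by split.
  by case: nw; rewrite -e E hw.
- have old i p : i < n -> start i + 2 <= p < P i -> X p < rank (inp p) i ->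
    exists2 i', upd H w m.+1 (inp p) = i'.+1 & rank (inp p) i' <= rank (inp p) i.
    move=> li rp xp; have [i' hi' ri'] := rej i p li rp xp.
    rewrite /upd; case: eqP => [E|_]; last by exists i'.
    exists m => //; rewrite E in hi' ri' *; move: hi'; rewrite Hh => -[E2].
    by rewrite -E2 in ri'; lia.
  move=> i p li; rewrite {1}/upd; case: eqP => [->|_]; last exact: old.
  rewrite ltnS => /andP[a]; rewrite leq_eqVlt => /orP[/eqP -> _|b]; last first.
    by apply: old => //; rewrite a.
  by rewrite hw /upd eqxx; exists m => //; apply: ltnW.
Qed.

End GaleShapley.

(** * The program *)

Declare Scope hl_scope.
Local Notation "$ x" := (Var x) (at level 1, format "$ x") : hl_scope.
Local Notation "# c" := (Cst c) (at level 1, format "# c") : hl_scope.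
Local Notation "k [! e !]" := (Get k e) (at level 2, format "k [! e !]") : hl_scope.
Local Notation "x <~ e" := (HSet x e) (at level 86, no associativity) : hl_scope.
Local Notation "k [! e !] <~ v" := (HPut k e v) (at level 2, v at level 85) : hl_scope.
Local Notation "p ;; q" := (HSeq p q) (at level 88, right associativity) : hl_scope.
Local Notation "a [+] b" := (Plus a b) (at level 50, left associativity) : hl_scope.
Local Notation "a [-] b" := (Minus a b) (at level 50, left associativity) : hl_scope.
Local Open Scope hl_scope.

Local Notation vN := 0 (only parsing).
Local Notation vn := 1 (only parsing).
Local Notation vq := 2 (only parsing).
Local Notation vt := 3 (only parsing).
Local Notation vi := 4 (only parsing).
Local Notation vp := 5 (only parsing).
Local Notation vc := 6 (only parsing).
Local Notation vdm := 7 (only parsing).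
Local Notation vdw := 8 (only parsing).
Local Notation vb := 9 (only parsing).
Local Notation vgo := 10 (only parsing).
Local Notation vok := 11 (only parsing).
Local Notation vm := 12 (only parsing).
Local Notation vm0 := 13 (only parsing).
Local Notation vj := 14 (only parsing).
Local Notation vl := 15 (only parsing).
Local Notation vw := 16 (only parsing).
Local Notation vr := 17 (only parsing).
Local Notation vh := 18 (only parsing).

(* [aS] holds the input position of each person, [aC] the multiples of the number
   [n] of men, [aT] at index [w * n + m] the rank of [m] for [w], [aD] the digits of
   the current code, and [aX], [aP], [aH] the functions of [gs_done]. *)
Local Notation aI := 0 (only parsing).
Local Notation aOut := 1 (only parsing).
Local Notation aS := 2 (only parsing).
Local Notation aC := 3 (only parsing).
Local Notation aT := 4 (only parsing).
Local Notation aD := 5 (only parsing).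
Local Notation aX := 6 (only parsing).
Local Notation aH := 7 (only parsing).
Local Notation aP := 8 (only parsing).

Definition parse_init : hcmd :=
  vn <~ aI[!#0!] ;; vq <~ aI[!#1!] ;; vt <~ $vn [+] $vq ;; vi <~ #0 ;; vp <~ #2 ;;
  vc <~ #0 ;; vdm <~ #0 ;; vdw <~ #0.

(* [a + (b - a)] is the maximum, since subtraction is truncated. *)
Definition parse_step : hcmd :=
  aS[!$vi!] <~ $vp ;; aC[!$vi!] <~ $vc ;; vc <~ $vc [+] $vn ;; vl <~ aI[!$vp [+] #1!] ;;
  vp <~ $vp [+] $vl [+] #2 ;; vi <~ $vi [+] #1 ;;
  HIf (HLt $vn $vi) (vdw <~ $vdw [+] ($vl [-] $vdw)) (vdm <~ $vdm [+] ($vl [-] $vdm)).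

Definition parse : hcmd :=
  parse_init ;; HWhile (HLt $vi $vt) parse_step ;; aS[!$vi!] <~ $vp.

(** A scan of the women's lists; moving on to the next woman skips her flag and the length of her
    list. Unlisted pairs are never written, so their rank 0 is the initial content of memory. *)
Definition table_step : hcmd :=
  HIf (HEq $vp aS[!$vi [+] #1!])
      (vi <~ $vi [+] #1 ;; vp <~ $vp [+] #2)
      (aT[!aC[!$vi [-] $vn!] [+] aI[!$vp!]!] <~ $vp ;; vp <~ $vp [+] #1).

Definition table : hcmd :=
  (vi <~ $vn ;; vp <~ aS[!$vn!] [+] #2) ;; HWhile (HLt $vi $vt) table_step.

Definition width_step : hcmd :=
  HIf (HEq aI[!aS[!$vi!]!] #0) HSkip
      (HIf (HLt $vi $vn) (vb <~ $vb [+] ($vdw [-] #1)) (vb <~ $vb [+] ($vdm [-] #1))) ;;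
  vi <~ $vi [+] #1.

Definition compute_width : hcmd :=
  (vi <~ #0 ;; vb <~ #0) ;; HWhile (HLt $vi $vt) width_step ;;
  HIf (HLt $vN $vb) (vb <~ $vN) HSkip.

Definition clear_step : hcmd :=
  aX[!$vi!] <~ #0 ;; aH[!$vi!] <~ #0 ;; aP[!$vi!] <~ aS[!$vi!] [+] #2 ;; vi <~ $vi [+] #1.

Definition clear : hcmd := vi <~ #0 ;; HWhile (HLt $vi $vN) clear_step.

Definition delete_step : hcmd := aX[!aD[!$vj!]!] <~ $vN ;; vj <~ $vj [+] #1.

Definition delete : hcmd := vj <~ #0 ;; HWhile (HLt $vj $vb) delete_step.

(** The comparison of [aX] with the rank tests acceptability and deletion together: the rank is 0 if
    the woman does not list the man, [aX] is [N] at deleted cells, and the ranks of listed men lie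
    strictly between. *)
Definition propose_step : hcmd :=
  vp <~ aP[!$vm!] ;;
  HIf (HEq $vp aS[!$vm [+] #1!])
      (vm0 <~ $vm0 [+] #1 ;; vm <~ $vm0)
      (vw <~ aI[!$vp!] ;; vr <~ aT[!aC[!$vw!] [+] $vm!] ;; vh <~ aH[!$vw!] ;;
       HIf (HLt aX[!$vp!] $vr)
           (HIf (HEq $vh #0)
                (aH[!$vw!] <~ $vm [+] #1 ;; vm0 <~ $vm0 [+] #1 ;; vm <~ $vm0)
                (HIf (HLt $vr aT[!aC[!$vw!] [+] ($vh [-] #1)!])
                     (aH[!$vw!] <~ $vm [+] #1 ;; vm <~ $vh [-] #1 ;; aP[!$vm!] <~ aP[!$vm!] [+] #1)
                     (aP[!$vm!] <~ $vp [+] #1)))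
           (aP[!$vm!] <~ $vp [+] #1)).

Definition propose : hcmd :=
  (vm0 <~ #0 ;; vm <~ #0) ;; HWhile (HLt $vm0 $vn) propose_step.

Definition check_step : hcmd :=
  HIf (HEq aI[!aS[!$vi!]!] #0) HSkip
      (HIf (HLt $vi $vn)
           (HIf (HEq aP[!$vi!] aS[!$vi [+] #1!]) (vok <~ #0) HSkip)
           (HIf (HEq aH[!$vi [-] $vn!] #0) (vok <~ #0) HSkip)) ;;
  vi <~ $vi [+] #1.

Definition check : hcmd :=
  (vi <~ #0 ;; vok <~ #1) ;; HWhile (HLt $vi $vt) check_step.

Definition carry_step : hcmd := aD[!$vj!] <~ #0 ;; vj <~ $vj [+] #1.

(** The digit at position [width] is 0 while the code is below [N ^ width] and becomes 1 when it
    reaches this bound, so it tells whether to go on. Being 0 before, it also stops the carry. *)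
Definition increment : hcmd :=
  vj <~ #0 ;; HWhile (HEq (aD[!$vj!] [+] #1) $vN) carry_step ;;
  (aD[!$vj!] <~ aD[!$vj!] [+] #1 ;; vgo <~ #1 [-] aD[!$vb!]).

Definition attempt : hcmd :=
  clear ;; delete ;; propose ;; check ;;
  HIf (HEq $vok #1) (vgo <~ #0) increment.

Definition report_step : hcmd :=
  HIf (HEq aP[!$vi!] aS[!$vi [+] #1!])
      (aOut[!$vi [+] #1!] <~ #0) (aOut[!$vi [+] #1!] <~ aI[!aP[!$vi!]!] [+] #1) ;;
  vi <~ $vi [+] #1.

(** The last assignment passes the output length to [store_output] through register 0. The cells of
    the men are written after a failed search as well; the answer then constrains cell 0 only. *)
Definition report : hcmd :=
  (aOut[!#0!] <~ $vok ;; vi <~ #0) ;; HWhile (HLt $vi $vn) report_step ;; vN <~ $vn [+] #1.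

Definition smc_program : hcmd :=
  parse ;; table ;; compute_width ;; vgo <~ #1 ;; HWhile (HEq $vgo #1) attempt ;; report.

Local Ltac hsimp := rewrite /= /upda /upd /=.

(** * Parsing, the table of ranks and the width *)

Section Verification.
Variable I : smc.
Local Notation n := (nmen I).
Local Notation q := (nwomen I).
Local Notation N := (isize I).
Local Notation inp := (inp I).
Local Notation start := (start I).
Local Notation rank := (rank I).
Local Notation width := (width I).

Variable B : nat.
(** Quadratic words are required by the indices [w * n + m] of the table and by the width before it
    is capped. *)
Hypothesis B_ge : N * N + N + 16 <= B.

Let nqN : 2 * (n + q) + 2 <= N := size_persons_lt I.

Definition maxlist (f : nat -> bool) i := \max_(0 <= j < i) (if f j then size (plist I j) else 0).

(** [aS] is bounded at all indices because the loop of [clear] runs up to [N] and reads it beyond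
    the last person. *)
Record parsed s : Prop := Parsed {
  pd_N : var s vN = N; pd_n : var s vn = n; pd_t : var s vt = n + q;
  pd_I : arr s aI = inp;
  pd_S : forall i, i <= n + q -> arr s aS i = start i;
  pd_C : forall i, i < n + q -> arr s aC i = i * n;
  pd_Sle : forall i, arr s aS i <= N
}.

Lemma parsed_frame p s s' : frame p s s' -> ~~ has [in wvars p] [:: vN; vn; vt] ->
  ~~ has [in warrs p] [:: aI; aS; aC] -> parsed s -> parsed s'.
Proof.
rewrite /= !negb_or => -[fv fa] /and4P[a b c _] /and4P[d e f _] [h1 h2 h3 h4 h5 h6 h7].
by split; rewrite ?fv ?fa.
Qed.

Lemma maxlistS f i : maxlist f i.+1 = maxn (maxlist f i) (if f i then size (plist I i) else 0).
Proof. by rewrite /maxlist big_nat_recr. Qed.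

Lemma run_parse s : var s vN = N -> arr s aI = inp -> (forall i, arr s aS i = 0) ->
  hrun B parse s (hcost parse_init + ((N * (hcost parse_step).+1).+1 + 1))
   (fun s' => [/\ parsed s', var s' vdm = maxlist (fun j => j < n) (n + q)
     & var s' vdw = maxlist (fun j => n <= j) (n + q)]).
Proof.
move=> sN sI sS.
apply: (@hrun_seq _ _ _ _ _ _ _ (fun s' => [/\ var s' vn = n, var s' vt = n + q, 
   var s' vi = 0, var s' vp = 2 & [/\ var s' vc = 0, var s' vdm = 0 & var s' vdw = 0]])).
  apply: hrun_do; hsimp; rewrite sI inp0 inp1 //.
  by do ?split; lia.
move=> s1 [fv fa] [s1n s1t s1i s1p [s1c s1dm s1dw]].
have s1N : var s1 vN = N by rewrite fv.
have s1I : arr s1 aI = inp by rewrite fa.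
pose Inv k s' := [/\ k + var s' vi = n + q, var s' vp = start (var s' vi),
  var s' vc = var s' vi * n, forall j, j < var s' vi -> arr s' aS j = start j /\ arr s' aC j = j * n
  & [/\ var s' vdm = maxlist (fun j => j < n) (var s' vi),
    var s' vdw = maxlist (fun j => n <= j) (var s' vi) & forall j, arr s' aS j <= N]].
apply: (@hrun_seq _ _ _ _ _ _ _ (fun s' => Inv 0 s')).
  apply: hrun_weaken.
  - apply: (@hrun_while _ _ _ _ (hcost parse_step) (n + q) Inv).
    + rewrite /Inv s1i s1p s1c s1dm s1dw addn0 start0 /maxlist !big_geq //; split=> //; split=> // j.
      by rewrite fa // sS.
    + by [].
    + move=> k s' [Ek Ep Ec Ej [Edm Edw Ele]] [fv' fa'] /=.
      have s'n : var s' vn = n by rewrite fv'.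
      have s'I : arr s' aI = inp by rewrite fa'.
      rewrite (fv' vt) // s1t; set i := var s' vi in Ek Ep Ec Ej Edm Edw * => lt.
      have le1 := start_le (ltnW lt); have SS := startS lt; have le2 := start_le lt.
      have sz := inp_size lt.
      have ci : i * n + n <= N * N by nia.
      have mx1 f : maxlist f i <= N.
        by apply/bigmax_leqP_seq => j; rewrite mem_index_iota => /andP[_ lj] _;
          case: (f j) => //; have := @plist_size_lt I j; lia.
      have m1 := mx1 (fun j => j < n); have m2 := mx1 (fun j => n <= j).
      apply: hrun_do.
        hsimp; rewrite -/i Ep Ec s'n s'I sz Edm Edw.
        by do ?split; try lia; case: ifP => _; do ?split; lia.
      exists k.-1; first by lia.
      hsimp; rewrite -/i Ep Ec s'n s'I sz Edm Edw.
      have Ej' j : j < i + 1 -> (if j == i then start i else arr s' aS j) = start j /\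
          (if j == i then i * n else arr s' aC j) = j * n.
        by case: eqP => [-> //|ne] lj; apply: Ej; lia.
      have Ele' j : (if j == i then start i else arr s' aS j) <= N by case: eqP.
      case: ifP => ni; rewrite /Inv; hsimp; split=> //; try by lia.
      * by rewrite addn1 SS.
      * have [e1 e2] : (i < n) = false /\ n <= i by lia.
        by rewrite addn1 !maxlistS e1 e2 maxn0 -maxnE Edm.
      * by rewrite addn1 SS.
      * have [e1 e2] : i < n /\ (n <= i) = false by lia.
        by rewrite addn1 !maxlistS e1 e2 maxn0 -maxnE Edw.
  - by rewrite ltnS leq_mul2r; apply/orP; right; lia.
  - move=> s' [fv' _] [nh [k [Ek Ep Ec Ej Em]]]; split=> //.
    by move: nh; rewrite /= (fv' vt) // s1t; lia.
move=> s' [fv' fa'] [Ei Ep Ec Ej [Edm Edw Ele]]; rewrite add0n in Ei.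
apply: hrun_do => //; hsimp; rewrite Edm Edw Ei; split=> //.
split; hsimp; rewrite ?(fv' vN) ?(fv' vn) ?(fv' vt) ?(fa' aI) //.
- move=> i; rewrite leq_eqVlt; case: eqP => [->|_] /=; first by rewrite Ep Ei.
  by move=> lt; apply: (Ej i _).1; rewrite Ei.
- by move=> i lt; apply: (Ej i _).2; rewrite Ei.
- by move=> i; case: eqP => // _; rewrite Ep Ei start_end.
Qed.



Lemma pair_index_inj k w m w' m' : m < k -> m' < k ->
  w * k + m = w' * k + m' -> w = w' /\ m = m'.
Proof.
move=> lm lm' E; have k0 : 0 < k by apply: leq_trans lm.
have Ew : w = w'.
  by have := congr1 (divn^~ k) E; rewrite /= !divnMDl // !divn_small // !addn0.
by split=> //; move: E; rewrite Ew => /addnI.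
Qed.

Lemma run_table s : parsed s -> (forall i, arr s aT i = 0) ->
  hrun B table s (2 + (N * (hcost table_step).+1).+1)
    (fun s' => forall w m, w < q -> m < n -> arr s' aT (w * n + m) = rank w m).
Proof.
move=> ps T0; have [sN sn st sI sS sC sle] := ps.
have le0 : start n <= N by apply: start_le; lia.
apply: (@hrun_seq _ _ _ _ _ _ _ (fun s' => var s' vi = n /\ var s' vp = start n + 2)).
  apply: hrun_do; hsimp; rewrite sn sS //; try lia.
  by do ?split; lia.
move=> s1 fr [s1i s1p]; have ps1 := parsed_frame fr isT isT ps.
(* The cells before [vp] have been entered in the table. The scan ends at [N + 2], not [N]: leaving
   the last woman also skips two cells. *)
pose Inv k s' := [/\ k + var s' vp = N + 2, n <= var s' vi <= n + q,
  start (var s' vi) + 2 <= var s' vp,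
  var s' vi < n + q -> var s' vp <= start (var s' vi).+1 &
  forall w m, w < q -> m < n ->
    arr s' aT (w * n + m) = if rank w m < var s' vp then rank w m else 0].
apply: hrun_weaken.
- apply: (@hrun_while _ _ _ _ (hcost table_step) (N - start n) Inv).
  + rewrite /Inv s1i s1p; split=> //; try lia.
    * by move=> lt; rewrite startS //; lia.
    * move=> w m lw lm; case: fr => _ fa; rewrite fa // T0; case: ifP => // lt.
      case: (eqVneq (rank w m) 0) => // /(rankP lw)[/andP[le _] _ _].
      by have := @start_mono I n (n + w); lia.
  + by [].
  + move=> k s' [Ek Ei Ep Ep2 ET] fr' /=.
    have [s'N s'n s't s'I s'S s'C s'le] := parsed_frame fr' isT isT ps1.
    set i := var s' vi in Ei Ep Ep2 Ek *; set p := var s' vp in Ek Ep Ep2 ET *.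
    rewrite s't => lt; have le2 := start_le lt; have {}Ep2 := Ep2 lt.
    apply: hrun_do.
      hsimp; rewrite -/i -/p addn1 s'S //; split; first by do ?split; lia.
      case: eqP => [E|ne]; first by do ?split; lia.
      have := inp_le I p; rewrite s'n s'C ?s'I; last by lia.
      by move=> ?; do ?split; try lia; nia.
    hsimp; rewrite -/i -/p addn1 s'S //; case: eqP => [E|ne].
      exists k.-2; first by lia.
      rewrite /Inv; hsimp; rewrite -/i -/p ?addn1; split=> //; try lia.
        by move=> lt2; rewrite startS //; lia.
      move=> w m lw lm; rewrite ET //.
      (* The two skipped cells hold the flag and the length of the next woman, or lie beyond the
         input; neither is a rank. *)
      suff -> : (rank w m < p + 2) = (rank w m < p) by [].
      have rN := rank_lt m lw.
      apply/idP/idP => [h|]; last by lia.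
      rewrite ltnNge; apply/negP => ge.
      have nz : rank w m != 0 by rewrite -lt0n; lia.
      have [/andP[r1 r2] _ _] := rankP lw nz.
      have li1 : i.+1 < n + q.
        rewrite ltn_neqAle lt andbT; apply/eqP => E2.
        by move: E; rewrite E2 start_end => E; lia.
      have SS := startS li1.
      have nwi : n + w = i.+1 by apply: (@start_inj I _ _ (rank w m)); lia.
      by rewrite nwi in r1; lia.
    have pr : start i + 2 <= p < start i.+1 by lia.
    have lw0 : i - n < q by lia.
    have Ei' : n + (i - n) = i by lia.
    have rk : rank (i - n) (inp p) = p by apply: rank_at; rewrite ?Ei'.
    have lm0 : inp p < n.
      have [|_ _ //] := @rankP I (i - n) (inp p) lw0.
      by rewrite rk; lia.
    exists k.-1; first by lia.
    rewrite /Inv; hsimp; rewrite -/i -/p s'n s'I s'C; last by lia.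
    split=> //; try lia.
    move=> w m lw lm; case: eqP => [/(pair_index_inj lm lm0)[-> ->]|nwm].
      by rewrite rk addn1 ltnSn.
    rewrite ET //; suff -> : (rank w m < p + 1) = (rank w m < p) by [].
    rewrite addn1 ltnS leq_eqVlt; case: eqP => // E; case: nwm.
    have nz : rank w m != 0 by lia.
    have [r1 r2 _] := rankP lw nz; rewrite E in r1 r2.
    have -> : w = i - n by have := @start_inj I (n + w) i p; lia.
    by rewrite r2.
- by rewrite ltnS leq_mul2r leq_subr orbT.
- move=> s' fr' [nh [k [Ek Ei Ep Ep2 ET]]] w m lw lm.
  have [_ _ s't _ _ _ _] := parsed_frame fr' isT isT ps1.
  have Ei' : var s' vi = n + q by move: nh; rewrite /= s't; lia.
  rewrite Ei' start_end in Ep.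
  by rewrite ET //; have := rank_lt m lw; case: ifP => //; lia.
Qed.

Lemma maxlist_men : maxlist (fun j => j < n) (n + q) = DeltaM I.
Proof.
rewrite /maxlist big_mkord big_split_ord /= [X in maxn _ X]big1 ?maxn0; last first.
  by move=> w _; rewrite ltnNge leq_addr.
by apply: eq_bigr => m _; rewrite ltn_ord plist_man size_map.
Qed.

Lemma maxlist_women : maxlist (fun j => n <= j) (n + q) = DeltaW I.
Proof.
rewrite /maxlist big_mkord big_split_ord /= big1 ?max0n; last first.
  by move=> m _; rewrite leqNgt ltn_ord.
by apply: eq_bigr => w _; rewrite leq_addr plist_woman size_map.
Qed.

Definition star_weight j :=
  if star I j == 0 then 0 else if j < n then DeltaW I - 1 else DeltaM I - 1.

Lemma sum_star_weight : \sum_(0 <= j < n + q) star_weight j = deletion_bound I.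
Proof.
rewrite big_mkord big_split_ord /= addnC /deletion_bound; congr (_ + _).
  rewrite mulnC -sum_nat_const [RHS]big_mkcond /=; apply: eq_bigr => w _.
  by rewrite /star_weight star_woman ltnNge leq_addr; case: (w \in _).
rewrite mulnC -sum_nat_const [RHS]big_mkcond /=; apply: eq_bigr => m _.
by rewrite /star_weight star_man ltn_ord; case: (m \in _).
Qed.

Lemma DeltaM_le : DeltaM I <= N.
Proof.
apply/bigmax_leqP => m _; have lt : m < n + q by have := ltn_ord m; lia.
by have := plist_size_lt lt; rewrite plist_man size_map; apply: leq_trans; apply: leq_addr.
Qed.

Lemma DeltaW_le : DeltaW I <= N.
Proof.
apply/bigmax_leqP => w _; have lt : n + w < n + q by rewrite ltn_add2l.
by have := plist_size_lt lt; rewrite plist_woman size_map; apply: leq_trans; apply: leq_addr.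
Qed.

Lemma run_width s : parsed s -> var s vdm = DeltaM I -> var s vdw = DeltaW I ->
  hrun B compute_width s (2 + ((N * (hcost width_step).+1).+1 + 2))
    (fun s' => var s' vb = width).
Proof.
move=> ps sdm sdw; have [sN sn st sI sS sC sle] := ps.
apply: (@hrun_seq _ _ _ _ _ _ _ (fun s' => var s' vi = 0 /\ var s' vb = 0)).
  by apply: hrun_do.
move=> s1 fr [s1i s1b]; have ps1 := parsed_frame fr isT isT ps.
have s1dm : var s1 vdm = DeltaM I by rewrite fr.1.
have s1dw : var s1 vdw = DeltaW I by rewrite fr.1.
pose Inv k s' := [/\ k + var s' vi = n + q, var s' vb <= var s' vi * N &
  var s' vb = \sum_(0 <= j < var s' vi) star_weight j].
apply: (@hrun_seq _ _ _ _ _ _ _ (fun s' => var s' vb = deletion_bound I)).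
  apply: hrun_weaken.
  - apply: (@hrun_while _ _ _ _ (hcost width_step) (n + q) Inv) => //.
    + by rewrite /Inv s1i s1b addn0 big_geq.
    + move=> k s' [Ek le Eb] fr' /=.
      have [s'N s'n s't s'I s'S s'C s'le] := parsed_frame fr' isT isT ps1.
      have s'dm : var s' vdm = DeltaM I by rewrite fr'.1.
      have s'dw : var s' vdw = DeltaW I by rewrite fr'.1.
      set i := var s' vi in Ek le Eb *; rewrite s't => lt.
      have iN : i * N + N <= N * N by nia.
      have d1 := DeltaM_le; have d2 := DeltaW_le.
      have sw : \sum_(0 <= j < i.+1) star_weight j = var s' vb +
        if star I i == 0 then 0 else if i < n then DeltaW I - 1 else DeltaM I - 1.
        by rewrite big_nat_recr //= -Eb.
      apply: hrun_do.
        hsimp; rewrite -/i s'S ?(ltnW lt) // s'I inp_star // s'n s'dm s'dw.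
        by case: eqP => _; last case: ifP => _; hsimp; do ?split; lia.
      exists k.-1; first by lia.
      move: sw; rewrite /Inv; hsimp; rewrite -/i s'S ?(ltnW lt) // s'I inp_star //.
      rewrite s'n s'dm s'dw.
      by case: eqP => _; last case: ifP => _; hsimp; rewrite -/i ?addn1 => sw; split;
        rewrite ?addn1 ?sw; nia.
  - by rewrite ltnS leq_mul2r; apply/orP; right; lia.
  - move=> s' fr' [nh [k [Ek _ ->]]].
    have [_ _ s't _ _ _ _] := parsed_frame fr' isT isT ps1.
    have -> : var s' vi = n + q by move: nh; rewrite /= s't; lia.
    exact: sum_star_weight.
move=> s2 fr2 s2b; have ps2 := parsed_frame fr2 isT isT ps1.
apply: hrun_do; first by hsimp; case: ifP.
hsimp; rewrite (pd_N ps2) s2b /width /minn ltnNge leq_eqVlt.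
by case: ltngtP => //= h; rewrite ?s2b // (pd_N ps2).
Qed.

End Verification.

(** * The phases of one attempt *)

Section Search.
Variable I : smc.
Local Notation n := (nmen I).
Local Notation q := (nwomen I).
Local Notation N := (isize I).
Local Notation inp := (inp I).
Local Notation start := (start I).
Local Notation rank := (rank I).
Local Notation width := (width I).

Variable B : nat.
Hypothesis B_ge : N * N + N + 16 <= B.

Let nqN : 2 * (n + q) + 2 <= N := size_persons_lt I.

Record ready s : Prop := Ready {
  rd_parsed : parsed I s;
  rd_T : forall w m, w < q -> m < n -> arr s aT (w * n + m) = rank w m;
  rd_b : var s vb = width
}.

Lemma ready_frame p s s' : frame p s s' -> ~~ has [in wvars p] [:: vN; vn; vt; vb] ->
  ~~ has [in warrs p] [:: aI; aS; aC; aT] -> ready s -> ready s'.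
Proof.
move=> fr; rewrite /= !negb_or => /and5P[a b c d _] /and5P[e f g h _] [pd hT hb].
split; last by rewrite fr.1.
  by apply: parsed_frame fr _ _ pd; rewrite /= !negb_or ?a ?b ?c ?e ?f ?g.
by move=> w m; rewrite fr.2 //; apply: hT.
Qed.

Lemma run_clear s : ready s ->
  hrun B clear s (1 + (N * (hcost clear_step).+1).+1)
    (fun s' => [/\ forall p, p < N -> arr s' aX p = 0, forall w, w < q -> arr s' aH w = 0
      & forall i, i < n -> arr s' aP i = start i + 2]).
Proof.
move=> rs; apply: (@hrun_seq _ _ _ _ _ _ _ (fun s' => var s' vi = 0)); first exact: hrun_do.
move=> s1 fr s1i; have rs1 := ready_frame fr isT isT rs.
pose Inv k s' := k + var s' vi = N /\ forall j, j < var s' vi ->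
  [/\ arr s' aX j = 0, arr s' aH j = 0 & arr s' aP j = arr s' aS j + 2].
apply: hrun_weaken.
- apply: (@hrun_while _ _ _ _ (hcost clear_step) N Inv) => //.
  + by rewrite /Inv s1i addn0.
  + move=> k s' [Ek Ej] fr' /=.
    have [[s'N s'n s't s'I s'S s'C s'le] s'T s'b] := ready_frame fr' isT isT rs1.
    set i := var s' vi in Ek Ej *; rewrite s'N => lt.
    have le := s'le i.
    apply: hrun_do; first by hsimp; rewrite -/i; do ?split; lia.
    exists k.-1; first by lia.
    rewrite /Inv; hsimp; rewrite -/i; split; first by lia.
    by move=> j; case: eqP => [-> //|ne] lj; apply: Ej; lia.
- by [].
- move=> s' fr' [nh [k [Ek Ej]]].
  have [[s'N s'n s't s'I s'S s'C s'le] s'T s'b] := ready_frame fr' isT isT rs1.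
  have Ei : var s' vi = N by move: nh; rewrite /= s'N; lia.
  rewrite Ei in Ej; split=> [p lp|w lw|i li].
  + by have [] := Ej p lp.
  + by have [] : [/\ arr s' aX w = 0, arr s' aH w = 0 & arr s' aP w = arr s' aS w + 2]
      by apply: Ej; lia.
  + have [|_ _ ->] := Ej i; first by lia.
    by rewrite s'S //; lia.
Qed.

Lemma markedE v p : marked I v p = (p \in mkseq (digit N v) width).
Proof.
apply/existsP/mapP => [[j /eqP <-]|[j]]; first by exists (val j); rewrite // mem_iota /=.
by rewrite mem_iota /= add0n => lj ->; exists (Ordinal lj).
Qed.

Lemma run_delete s v : ready s -> arr s aD =1 digit N v ->
  (forall p, p < N -> arr s aX p = 0) ->
  hrun B delete s (1 + (N * (hcost delete_step).+1).+1)
    (fun s' => forall p, p < N -> arr s' aX p = if marked I v p then N else 0).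
Proof.
move=> rs Dv X0; apply: (@hrun_seq _ _ _ _ _ _ _ (fun s' => var s' vj = 0)); first exact: hrun_do.
move=> s1 fr s1j; have rs1 := ready_frame fr isT isT rs.
pose Inv k s' := k + var s' vj = width /\ forall p, p < N ->
  arr s' aX p = if p \in mkseq (digit N v) (var s' vj) then N else 0.
apply: hrun_weaken.
- apply: (@hrun_while _ _ _ _ (hcost delete_step) width Inv) => //.
  + by rewrite /Inv s1j addn0; split=> // p lp; rewrite fr.2 // X0.
  + move=> k s' [Ek Ep] fr' /=.
    have [[s'N s'n s't s'I s'S s'C s'le] s'T s'b] := ready_frame fr' isT isT rs1.
    have s'D : arr s' aD =1 digit N v by move=> j; rewrite fr'.2 // fr.2.
    set j := var s' vj in Ek Ep *; rewrite s'b => lt.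
    have wN : width <= N by apply: geq_minr.
    apply: hrun_do; first by hsimp; rewrite -/j; do ?split; lia.
    exists k.-1; first by lia.
    rewrite /Inv; hsimp; rewrite -/j s'D s'N; split; first by lia.
    move=> p lp; rewrite addn1 mkseqS mem_rcons inE Ep //.
    by case: eqP.
- by rewrite ltnS leq_mul2r geq_minr orbT.
- move=> s' fr' [nh [k [Ek Ep]]] p lp.
  have [[s'N s'n s't s'I s'S s'C s'le] s'T s'b] := ready_frame fr' isT isT rs1.
  have Ej : var s' vj = width by move: nh; rewrite /= s'b; lia.
  by rewrite Ep // Ej markedE.
Qed.

(** Besides his list, the block of each man has two header cells; they pay for his entry into the
    algorithm. *)
Lemma remaining_start P : (forall i, i < n -> P i = start i + 2) -> n + remaining I P <= N.
Proof.
move=> P0; have H i : i <= n -> i + \sum_(0 <= j < i) (start j.+1 - P j) <= start i.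
  elim: i => [|i IH] lt; first by rewrite big_geq.
  rewrite big_nat_recr //= P0 // startS; last by lia.
  by have := IH (ltnW lt); lia.
rewrite /remaining -(big_mkord xpredT (fun j => start j.+1 - P j)).
by apply: leq_trans (H n (leqnn _)) (start_le _); lia.
Qed.

Lemma run_propose s : ready s -> (forall i, i < n -> arr s aP i = start i + 2) ->
  (forall w, w < q -> arr s aH w = 0) ->
  hrun B propose s (2 + (N * (hcost propose_step).+1).+1)
    (fun s' => gs_done I (arr s' aX) (arr s' aP) (arr s' aH)).
Proof.
move=> rs P0 H0.
apply: (@hrun_seq _ _ _ _ _ _ _ (fun s' => var s' vm0 = 0 /\ var s' vm = 0)).
  exact: hrun_do.
move=> s1 fr [s1m0 s1m]; have rs1 := ready_frame fr isT isT rs.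
pose Inv k s' := gs_inv I (arr s' aX) (var s' vm0) (var s' vm) k (arr s' aP) (arr s' aH).
apply: hrun_weaken.
- apply: (@hrun_while _ _ _ _ (hcost propose_step) (n + remaining I (arr s aP)) Inv) => //.
  + by rewrite /Inv s1m0 s1m !(fr.2 aP, fr.2 aH) //; apply: gs_inv_start.
  + move=> k s' inv fr' /=.
    have [[s'N s'n s't s'I s'S s'C s'le] s'T s'b] := ready_frame fr' isT isT rs1.
    rewrite s'n => lt0.
    have lm : var s' vm < n by have := gsi_m inv; lia.
    have lmq : (var s' vm).+1 <= n + q by lia.
    have rg := gsi_range inv lm; have le := start_le lmq.
    have eS : arr s' aS (var s' vm + 1) = start (var s' vm).+1 by rewrite addn1 s'S.
    case: (eqVneq (arr s' aP (var s' vm)) (start (var s' vm).+1)) => [E|ne].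
      have [inv' lk] := gs_inv_exhausted lt0 inv E.
      apply: hrun_do; hsimp; rewrite eS E eqxx; first by hsimp; do ?split; lia.
      by exists k.-1 => //; rewrite /Inv; hsimp; rewrite addn1.
    have ltP : arr s' aP (var s' vm) < start (var s' vm).+1 by lia.
    have lw : inp (arr s' aP (var s' vm)) < q by apply: (inp_man_lt lm); lia.
    have eC : arr s' aC (inp (arr s' aP (var s' vm))) = inp (arr s' aP (var s' vm)) * n.
      by rewrite s'C //; lia.
    have eT := s'T _ _ lw lm.
    have bd : inp (arr s' aP (var s' vm)) * n + n <= N * N by nia.
    case: (ltnP (arr s' aX (arr s' aP (var s' vm))) (rank (inp (arr s' aP (var s' vm))) (var s' vm)))
      => [val|inval]; last first.
      have [|inv' lk] := gs_inv_advance lt0 inv ltP; first by rewrite ltnNge inval.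
      apply: hrun_do; hsimp; rewrite eS (negbTE ne) s'I; hsimp;
        rewrite eC eT [_ < rank _ _]ltnNge inval; first by hsimp; do ?split; lia.
      by exists k.-1 => //; rewrite /Inv; hsimp; rewrite addn1.
    case Hw: (arr s' aH (inp (arr s' aP (var s' vm)))) => [|h].
      have [inv' lk] := gs_inv_accept lt0 inv ltP val Hw.
      apply: hrun_do; hsimp; rewrite eS (negbTE ne) s'I; hsimp;
        rewrite eC eT val Hw; first by hsimp; do ?split; lia.
      by exists k.-1 => //; rewrite /Inv; hsimp; rewrite !addn1.
    have [lh _ _ ltPh _] := gsi_woman inv lw Hw.
    have lhq : h.+1 <= n + q by lia.
    have leh := start_le lhq.
    have eTh := s'T _ _ lw lh.
    case: (ltnP (rank (inp (arr s' aP (var s' vm))) (var s' vm))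
                (rank (inp (arr s' aP (var s' vm))) h)) => [better|worse].
      have [inv' lk] := gs_inv_displace lt0 inv ltP val Hw better.
      apply: hrun_do; hsimp; rewrite eS (negbTE ne) s'I; hsimp;
        rewrite eC eT val Hw; hsimp; rewrite subn1 /= eTh better; first by hsimp; do ?split; lia.
      by exists k.-1 => //; rewrite /Inv; hsimp; rewrite !addn1.
    have [|inv' lk] := gs_inv_advance lt0 inv ltP; first by exists h.
    apply: hrun_do; hsimp; rewrite eS (negbTE ne) s'I; hsimp;
      rewrite eC eT val Hw; hsimp; rewrite subn1 /= eTh [rank _ _ < rank _ _]ltnNge worse; first by hsimp; do ?split; lia.
    by exists k.-1 => //; rewrite /Inv; hsimp; rewrite addn1.
- by rewrite ltnS leq_mul2r remaining_start ?orbT.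
- move=> s' fr' [nh [k inv]].
  have [[s'N s'n s't s'I s'S s'C s'le] s'T s'b] := ready_frame fr' isT isT rs1.
  by apply: gs_inv_done inv _; move: nh; rewrite /= s'n -leqNgt.
Qed.

Definition ok_upto P H i := all (fun j => (star I j != 0) ==> covered I P H j) (iota 0 i).

Lemma ok_uptoS P H i :
  ok_upto P H i.+1 = ok_upto P H i && ((star I i != 0) ==> covered I P H i).
Proof. by rewrite /ok_upto -addn1 iotaD all_cat /= andbT. Qed.

Lemma run_check s : ready s ->
  hrun B check s (2 + (N * (hcost check_step).+1).+1)
    (fun s' => var s' vok = ok_upto (arr s' aP) (arr s' aH) (n + q)).
Proof.
move=> rs.
apply: (@hrun_seq _ _ _ _ _ _ _ (fun s' => var s' vi = 0 /\ var s' vok = 1)).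
  exact: hrun_do.
move=> s1 fr [s1i s1ok]; have rs1 := ready_frame fr isT isT rs.
pose Inv k s' := k + var s' vi = n + q /\
  var s' vok = ok_upto (arr s' aP) (arr s' aH) (var s' vi).
apply: hrun_weaken.
- apply: (@hrun_while _ _ _ _ (hcost check_step) (n + q) Inv) => //.
  + by rewrite /Inv s1i addn0 s1ok.
  + move=> k s' [Ek Eok] fr' /=.
    have [[s'N s'n s't s'I s'S s'C s'le] s'T s'b] := ready_frame fr' isT isT rs1.
    set i := var s' vi in Ek Eok *; rewrite s't => lt.
    have eS : arr s' aS (i + 1) = start i.+1 by rewrite addn1 s'S.
    apply: hrun_do.
      hsimp; rewrite -/i eS s'S ?(ltnW lt) // s'I inp_star // s'n.
      by do ![case: eqP => _|case: ifP => _]; hsimp; do ?split; lia.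
    exists k.-1; first by lia.
    have := ok_uptoS (arr s' aP) (arr s' aH) i; rewrite /covered /Inv.
    hsimp; rewrite -/i eS s'S ?(ltnW lt) // s'I inp_star // s'n.
    by do ![case: eqP => _|case: ifP => _]; hsimp; rewrite -/i ?addn1 ?andbT ?andbF => ->;
      split => //; lia.
- by rewrite ltnS leq_mul2r; apply/orP; right; lia.
- move=> s' fr' [nh [k [Ek ->]]].
  have [[s'N s'n s't s'I s'S s'C s'le] s'T s'b] := ready_frame fr' isT isT rs1.
  by congr (nat_of_bool (ok_upto _ _ _)); move: nh; rewrite /= s't; lia.
Qed.

Lemma run_increment s v : ready s -> arr s aD =1 digit N v -> v < N ^ width ->
  hrun B increment s (1 + ((N * (hcost carry_step).+1).+1 + 2))
    (fun s' => arr s' aD =1 digit N v.+1 /\ var s' vgo = (v.+1 < N ^ width)).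
Proof.
move=> rs Dv lv; have N1 := N_gt1 I.
apply: (@hrun_seq _ _ _ _ _ _ _ (fun s' => var s' vj = 0)); first exact: hrun_do.
move=> s1 fr s1j; have rs1 := ready_frame fr isT isT rs.
pose Inv k s' := [/\ k + var s' vj = width, N ^ var s' vj %| v.+1 &
  forall i, arr s' aD i = if i < var s' vj then 0 else digit N v i].
apply: (@hrun_seq _ _ _ _ _ _ _ (fun s' => [/\ var s' vj <= width, N ^ var s' vj %| v.+1,
  (digit N v (var s' vj)).+1 != N &
  forall i, arr s' aD i = if i < var s' vj then 0 else digit N v i])).
  apply: hrun_weaken.
  - apply: (@hrun_while _ _ _ _ (hcost carry_step) width Inv) => //.
    + by rewrite /Inv s1j addn0 expn0 dvd1n; split=> // i; rewrite fr.2.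
    + move=> k s' [Ek Edv ED] fr' /=; rewrite ED ltnn.
      by have := digit_lt N1 v (var s' vj); do ?split; lia.
    + move=> k s' [Ek Edv ED] fr' /=.
      have [[s'N s'n s't s'I s'S s'C s'le] s'T s'b] := ready_frame fr' isT isT rs1.
      set j := var s' vj in Ek Edv ED *; rewrite s'N ED ltnn addn1 => dj.
      (* The code is below [N ^ width], so its digit at [width] is 0, which differs from [N - 1]. *)
      have jw : j != width.
        apply: contraTneq dj => ->; rewrite (digit_small N1 lv (leqnn _)).
        by apply/eqP; lia.
      have wN : width <= N by apply: geq_minr.
      apply: hrun_do; first by hsimp; rewrite -/j; do ?split; lia.
      exists k.-1; first by lia.
      rewrite /Inv; hsimp; rewrite -/j addn1; split; first by lia.
        by rewrite digit_carry.
      by move=> i; rewrite ED ltnS; case: (ltngtP i j).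
  - by rewrite ltnS leq_mul2r geq_minr orbT.
  - move=> s' fr' [nh [k [Ek Edv ED]]].
    have [[s'N s'n s't s'I s'S s'C s'le] s'T s'b] := ready_frame fr' isT isT rs1.
    split=> //; first by lia.
    by move: nh; rewrite /= ED ltnn s'N addn1.
move=> s2 fr2 [jw dvj ne ED]; have rs2 := ready_frame fr2 isT isT rs1.
have dl := digit_lt N1 v (var s2 vj).
apply: hrun_do; hsimp; rewrite ED ltnn; first by do ?split; lia.
have ED' i : (if i == var s2 vj then digit N v (var s2 vj) + 1 else arr s2 aD i) = digit N v.+1 i.
  by rewrite (digit_succ N1 i dvj ne) addn1 ED; case: ltngtP.
split=> //; rewrite (rd_b rs2) ED'.
case: (ltnP v.+1 (N ^ width)) => [lt|ge]; first by rewrite (digit_small N1 lt).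
have -> : v.+1 = N ^ width by lia.
by rewrite /digit divnn expn_gt0 (ltnW N1) modn_small.
Qed.

End Search.

(** * The search loop and the complete program *)

Section Program.
Variable I : smc.
Local Notation n := (nmen I).
Local Notation q := (nwomen I).
Local Notation N := (isize I).
Local Notation inp := (inp I).
Local Notation start := (start I).
Local Notation width := (width I).

Variable B : nat.
Hypothesis B_ge : N * N + N + 16 <= B.

Let nqN : 2 * (n + q) + 2 <= N := size_persons_lt I.

Definition reported P i := if P i == start i.+1 then 0 else (inp (P i)).+1.

Definition found s := exists2 M : {set edge I}, optimal M & forall m : 'I_n,
  (if mpartner M m is Some w then (val w).+1 else 0) = reported (arr s aP) m.

Lemma run_attempt s v : ready I s -> arr s aD =1 digit N v -> v < N ^ width ->
  (forall u, u < v -> refuted I u) ->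
  hrun B attempt s (100 * N) (fun s' =>
    [/\ var s' vgo = 0, var s' vok = 1 & found s'] \/
    [/\ var s' vgo = (v.+1 < N ^ width), var s' vok = 0, arr s' aD =1 digit N v.+1
      & refuted I v]).
Proof.
move=> rs Dv lv ref.
(* The costs of clearing, deleting, proposing, checking and incrementing; they add up to
   [29 * N + 15]. *)
apply: (@hrun_weaken _ _ _ ((1 + (N * 5).+1) + ((1 + (N * 3).+1) + ((2 + (N * 12).+1) +
  ((2 + (N * 6).+1) + (1 + ((N * 3).+1 + 2)).+1))))) => [|//|]; last 2 first.
- by lia.
- by move=> s' _; exact.
apply: hrun_seq (run_clear B_ge rs) _ => s1 fr1 [X1 H1 P1].
have rs1 := ready_frame fr1 isT isT rs.
have D1 : arr s1 aD =1 digit N v by move=> j; rewrite fr1.2.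
apply: hrun_seq (run_delete B_ge rs1 D1 X1) _ => s2 fr2 X2.
have rs2 := ready_frame fr2 isT isT rs1.
have P2 i : i < n -> arr s2 aP i = start i + 2 by rewrite fr2.2 //; apply: P1.
have H2 w : w < q -> arr s2 aH w = 0 by rewrite fr2.2 //; apply: H1.
apply: hrun_seq (run_propose B_ge rs2 P2 H2) _ => s3 fr3 done3.
have rs3 := ready_frame fr3 isT isT rs2.
apply: hrun_seq (run_check B_ge rs3) _ => s4 fr4 ok4.
have rs4 := ready_frame fr4 isT isT rs3.
have done4 : gs_done I (arr s4 aX) (arr s4 aP) (arr s4 aH).
  by rewrite (fr4.2 aX) // (fr4.2 aP) // (fr4.2 aH).
have X4 p : p < N -> arr s4 aX p = if marked I v p then N else 0.
  by rewrite (fr4.2 aX) // (fr3.2 aX) //; apply: X2.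
have D4 : arr s4 aD =1 digit N v.
  by move=> j; rewrite (fr4.2 aD) // (fr3.2 aD) // (fr2.2 aD).
have stab := matching_of_stable done4 X4.
have feas : feasible (matching_of I (arr s4 aP)) <-> ok_upto I (arr s4 aP) (arr s4 aH) (n + q).
  rewrite (matching_of_feasible done4); split=> [h|/allP h i li st].
    apply/allP => i; rewrite mem_iota add0n => /= li.
    by apply/implyP; apply: h.
  by apply: (implyP (h i _)) => //; rewrite mem_iota.
apply: hrun_if => //; rewrite /= ok4.
case: (boolP (ok_upto _ _ _ _)) feas ok4 => okb [f1 f2] ok4 /=.
  apply: (@hrun_weaken _ _ _ 1 _ (fun s' => var s' vgo = 0)) => //; first exact: hrun_do.
  move=> s5 fr5 go5; left; split=> //; first by rewrite fr5.1.
  exists (matching_of I (arr s4 aP)).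
    by apply: first_unrefuted_optimal ref stab _ => //; apply: f2.
  by move=> m; rewrite (fr5.2 aP) // (mpartner_matching_of done4).
apply: hrun_weaken (run_increment B_ge rs4 D4 lv) _ _ => // s5 fr5 [D5 go5].
right; split=> //; first by rewrite fr5.1.
by exists (matching_of I (arr s4 aP)) => // /f1.
Qed.

Definition outcome s := var s vok = 1 /\ found s \/
  var s vok = 0 /\ forall M : {set edge I}, ~ feasible M.

Lemma run_search s : ready I s -> arr s aD =1 digit N 0 -> var s vgo = 1 ->
  hrun B (HWhile (HEq $vgo #1) attempt) s (N ^ width * (100 * N).+1).+1 outcome.
Proof.
move=> rs D0 go1; have N1 := N_gt1 I.
(* During the search [k] counts the codes still to be tried; afterwards only the outcome is
   recorded. *)
pose Inv k s' := (exists v, [/\ var s' vgo = 1, v + k = N ^ width, 0 < k,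
    arr s' aD =1 digit N v & forall u, u < v -> refuted I u]) \/
  (var s' vgo = 0 /\ outcome s').
apply: hrun_weaken.
- apply: (@hrun_while _ _ _ _ (100 * N) (N ^ width) Inv) => //.
  + by left; exists 0; split=> //; rewrite expn_gt0 (ltnW N1).
  + move=> k s' inv fr /= /eqP go'; have rs' := ready_frame fr isT isT rs.
    case: inv => [[v [_ Ek k0 Dv ref]]|[]]; last by rewrite go'.
    have lv : v < N ^ width by lia.
    apply: hrun_weaken (run_attempt rs' Dv lv ref) _ _ => // s2 fr2 [[go2 ok2 f2]|].
      by exists 0 => //; right; split=> //; left.
    move=> [go2 ok2 D2 refv].
    have ref' u : u < v.+1 -> refuted I u.
      by rewrite ltnS leq_eqVlt => /orP[/eqP -> //|]; apply: ref.
    exists k.-1; first by lia.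
    case: (ltnP v.+1 (N ^ width)) go2 => [lt|ge] go2.
      by left; exists v.+1; split=> //; lia.
    right; split=> //; right; split=> //; apply: all_refuted_infeasible => u lu.
    by apply: ref'; lia.
- by [].
- move=> s' fr [nh [k [[v [go' _ _ _ _]]|[]//]]].
  by move: nh; rewrite /= go'.
Qed.

Lemma run_report s : ready I s ->
  hrun B report s (2 + ((N * 5).+1 + 1)) (fun s' => [/\ var s' vN = n.+1,
    arr s' aOut 0 = var s vok & forall i, i < n -> arr s' aOut i.+1 = reported (arr s aP) i]).
Proof.
move=> rs.
apply: (@hrun_seq _ _ _ _ _ _ _ (fun s' => var s' vi = 0 /\ arr s' aOut 0 = var s vok)).
  exact: hrun_do.
move=> s1 fr [s1i s1o]; have rs1 := ready_frame fr isT isT rs.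
pose Inv k s' := [/\ k + var s' vi = n, arr s' aOut 0 = var s vok &
  forall i, i < var s' vi -> arr s' aOut i.+1 = reported (arr s aP) i].
apply: (@hrun_seq _ _ _ _ _ _ _ (Inv 0)).
  apply: hrun_weaken.
  - apply: (@hrun_while _ _ _ _ (hcost report_step) n Inv) => //.
    + by rewrite /Inv s1i addn0 s1o.
    + move=> k s' [Ek E0 Ei] fr' /=.
      have [[s'N s'n s't s'I s'S s'C s'le] s'T s'b] := ready_frame fr' isT isT rs1.
      have s'P : arr s' aP = arr s aP by rewrite fr'.2 // fr.2.
      set i := var s' vi in Ek Ei *; rewrite s'n => lt.
      have eS : arr s' aS (i + 1) = start i.+1 by rewrite addn1 s'S //; lia.
      have le := inp_le I (arr s aP i).
      apply: hrun_do.
        hsimp; rewrite -/i eS s'P s'I.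
        by case: eqP => _; hsimp; do ?split; lia.
      have Ei' : reported (arr s aP) i = if arr s aP i == start i.+1 then 0 else (inp (arr s aP i)).+1 by [].
      exists k.-1; first by lia.
      rewrite /Inv; hsimp; rewrite -/i eS s'P s'I; move: Ei'.
      case: eqP => _; hsimp => Ei'; rewrite -/i !addn1; split=> //=; try lia.
        by move=> j; rewrite ltnS eqSS leq_eqVlt; case: eqP => [-> //|_] /=; apply: Ei.
      by move=> j; rewrite ltnS eqSS leq_eqVlt; case: eqP => [-> //|_] /=; apply: Ei.
  - by rewrite /=; lia.
  - move=> s' fr' [nh [k [Ek E0 Ei]]].
    have [[s'N s'n s't s'I s'S s'C s'le] s'T s'b] := ready_frame fr' isT isT rs1.
    by split=> //; move: nh; rewrite /= s'n; lia.
move=> s2 fr2 [Ei2 E0 Ei]; have rs2 := ready_frame fr2 isT isT rs1.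
have s2n := pd_n (rd_parsed rs2).
apply: hrun_do; hsimp; rewrite s2n; first by do ?split; lia.
by rewrite addn1; split=> // i li; apply: Ei; lia.
Qed.

Lemma run_smc_program :
  hrun B smc_program (loaded (encode_smc I)) (300 * N ^ width.+1)
   (fun s => var s vN = n.+1 /\ exists2 y : option {set edge I}, smc_answer y &
     size (encode_answer y) <= n.+1 /\
     forall i, i < size (encode_answer y) -> arr s aOut i = nth 0 (encode_answer y) i).
Proof.
have N1 := N_gt1 I; have Nw : 0 < N ^ width by rewrite expn_gt0 (ltnW N1).
apply: (@hrun_weaken _ _ _ ((8 + ((N * 9).+1 + 1)) + ((2 + (N * 4).+1) + ((2 + ((N * 5).+1 + 2)) +
  (1 + ((N ^ width * (100 * N).+1).+1 + (2 + ((N * 5).+1 + 1)))))))) => [|//|]; last 2 first.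
- by rewrite expnSr; nia.
- by move=> s' _; exact.
set s0 := loaded _.
apply: hrun_seq (run_parse B_ge (s := s0) _ _ _) _ => // s1 fr1 [ps1].
rewrite maxlist_men maxlist_women => dm1 dw1.
have T1 i : arr s1 aT i = 0 by rewrite fr1.2.
apply: hrun_seq (run_table B_ge ps1 T1) _ => s2 fr2 T2.
have ps2 := parsed_frame fr2 isT isT ps1.
have dm2 : var s2 vdm = DeltaM I by rewrite fr2.1.
have dw2 : var s2 vdw = DeltaW I by rewrite fr2.1.
apply: hrun_seq (run_width B_ge ps2 dm2 dw2) _ => s3 fr3 b3.
have rs3 : ready I s3.
  split=> //; first exact: parsed_frame fr3 isT isT ps2.
  by move=> w m; rewrite fr3.2 //; apply: T2.
apply: (@hrun_seq _ _ _ _ _ _ _ (fun s => var s vgo = 1)); first exact: hrun_do.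
move=> s4 fr4 go4; have rs4 := ready_frame fr4 isT isT rs3.
have D4 : arr s4 aD =1 digit N 0.
  by move=> j; rewrite fr4.2 // fr3.2 // fr2.2 // fr1.2 //= /digit div0n mod0n.
apply: hrun_seq (run_search rs4 D4 go4) _ => s5 fr5 out5.
have rs5 := ready_frame fr5 isT isT rs4.
apply: hrun_weaken (run_report rs5) _ _ => // s6 fr6 [N6 o6 c6]; split=> //.
case: out5 => [[ok5 [M optM cM]]|[ok5 none]].
  exists (Some M) => //; split; first by rewrite /= size_map size_enum_ord.
  move=> [|i] /=; first by rewrite o6.
  rewrite size_map size_enum_ord ltnS => li.
  by rewrite c6 // -[i]/(val (Ordinal li)) nth_map_enum_ord cM.
by exists None => //; split=> // -[|//] _; rewrite o6.
Qed.

End Program.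

Theorem theorem7 :
  @solvable_in_time smc (fun I => option {set edge I})
    encode_smc encode_answer smc_answer
    (fun I => isize I ^ ((DeltaM I - 1) * #|wstar I|
                         + (DeltaW I - 1) * #|mstar I| + 1)).
Proof.
exists (Seq (Seq load_input (comp smc_program)) store_output).
(* The summand 40 pays for loading and storing, both linear. The exponent 9 gives room for
   [16 * B' + 16], which is 368 for the empty instance of size 2. *)
exists (comp_cost smc_program * 300 + 40), 9 => I.
have N1 := N_gt1 I; have nqN := size_persons_lt I.
set N := isize I in N1 nqN *.
set B' := N * N + N + 16.
have B16 : 16 <= B' by lia.
have Bge : 16 * B' + 16 <= size (encode_smc I) ^ 9.
  have -> : size (encode_smc I) ^ 9 = N * N * N ^ 7 by rewrite -mulnA -!expnS.
  have : 2 ^ 7 <= N ^ 7 by rewrite leq_exp2r.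
  by rewrite /B'; move: (N ^ 7) => x; nia.
have ltI i : nth 0 (encode_smc I) i < B' by have := inp_le I i; rewrite /inp -/N; lia.
have [|||||||s1 [t1 [x1 l1 sm1]]] :=
  @run_load_input B' _ (encode_smc I) (start I) (nmen I + nwomen I) B16 Bge _ ltI.
- by rewrite -/(isize I) -/N; lia.
- by rewrite -/(inp I) inp0 inp1.
- by rewrite -/(isize I) -/N; lia.
- exact: start0.
- exact: start_end.
- exact: start_le.
- by move=> i lt; rewrite startS // -/(inp I) inp_size.
have [h2 [t2 [x2 l2 [hN [y sol [sz out]]]]]] := run_smc_program (leqnn B').
have [s3 [t3 [x3 l3 sm3]]] := exec_comp B16 Bge x2 isT sm1.
have [s4 [t4 [x4 l4 out4]]] := run_store_output B16 Bge sm3.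
exists s4, (t1 + t3 + t4), y; split=> //.
- exact: ExecSeq (ExecSeq x1 x3) x4.
- rewrite hN in l4; rewrite -/(isize I) -/N in l1 l4 *.
  have e1 : N ^ (width I).+1 <= N ^ (deletion_bound I + 1).
    by rewrite addn1 leq_exp2l // ltnS geq_minl.
  have e2 : N <= N ^ (deletion_bound I + 1).
    by rewrite addn1 expnS leq_pmulr // expn_gt0 (ltnW N1).
  rewrite -/(deletion_bound I).
  move: (N ^ (deletion_bound I + 1)) e1 e2 => Z e1 e2.
  have l3' : t3 <= comp_cost smc_program * (300 * Z).
    apply: leq_trans l3 _; rewrite leq_mul2l; apply/orP; right.
    by apply: leq_trans l2 _; rewrite leq_mul2l e1 orbT.
  rewrite mulnDl -mulnA.
  move: (comp_cost smc_program * (300 * Z)) l3' => Y l3'.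
  by lia.
- by move=> i li; rewrite out4 ?out //; rewrite hN; apply: leq_trans li sz.
Qed.
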